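(* In the setting described in the context, the following three statements are equivalent: (1) Buyer's expected payoff is increasing in the informativeness of Seller's information structure, i.e., whenever an information structure $(X',\pi'^S)$ is more informative than $(X,\pi^S)$ in the sense of Blackwell, Buyer's expected payoff under $(X',\pi'^S)$ is at least as large as under $(X,\pi^S)$. (2) Full revelation to Seller maximizes Buyer's expected payoff among all information structures of Seller. (3) The inverse hazard rate satisfies \[ r(v)r''(v)+r'(v)\le 1 \quad\text{for all } v\in\big(\overline p(q_h),\overline p(q_\ell)\big). \]
   Context: Let $0<q_\ell<q_h<\infty$, $Q=[q_\ell,q_h]$, and let $c$ be a real number with $0<c<q_\ell$. Let $F$ be a probability distribution on $[0,1]$ with support $[0,1]$ admitting a twice continuously differentiable density $f:(0,1)\to\mathbb{R}_{>0}$. Define the inverse hazard rate $r(v)=(1-F(v))/f(v)$ and the virtual valuation $\psi(v)=v-r(v)$ on $(0,1)$, and assume $\psi'(v)>0$ whenever $\psi(v)>0$. For $q\in Q$, $p(q)$ is the unique maximizer over $p\in\mathbb{R}$ of $(p-c)\big(1-F(p/q)\big)$, and $\overline p(q)=p(q)/q$ (one has $0<\overline p(q_h)<\overline p(q_\ell)<1$). Model: the quality $q$ is drawn from a prior $\mu\in\Delta(Q)$ with support $Q$; Buyer's type $v\sim F$ is independent of $q$. Seller's information structure is $(X,\pi^S)$, with $X$ a measurable signal space and $\pi^S:Q\to\Delta(X)$; on observing $x$ Seller forms the Bayesian posterior $\mu^S_x$, and $\mu^S\in\Delta(Q)$ denotes the distribution of Seller's posterior mean $\mathbb{E}_{\mu^S_x}[q]$.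 The distribution $\mu^B$ of Buyer's posterior means is assumed to equal $\mu^S$. Buyer's expected payoff is $\mathbb{E}_{(q,v)\sim\mu^B\times F}[\max\{vq-p(q),0\}]$. Full revelation is the information structure with $X=Q$ and $\pi^S(\cdot\mid q)$ the point mass at $q$. *)

(* Defs.v *)
From HB Require Import structures.
From mathcomp Require Import all_boot all_order all_algebra.
From mathcomp Require Import all_classical all_reals all_analysis.
From mathcomp Require Import measurable_realfun.
Set Implicit Arguments. Unset Strict Implicit. Unset Printing Implicit Defensive.
Import Order.TTheory GRing.Theory Num.Theory.
Import numFieldNormedType.Exports.
Local Open Scope classical_set_scope.
Local Open Scope ring_scope.

Definition dens_cdf (R : realType) (f : R -> R) (v : R) : R :=
  fine (\int[@lebesgue_measure R]_(x in `[0, 1] `&` `]-oo, v]) (f x)%:E).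

Definition inv_hazard (R : realType) (f : R -> R) (v : R) : R :=
  (1 - dens_cdf f v) / f v.

Definition virtual_val (R : realType) (f : R -> R) (v : R) : R :=
  v - inv_hazard f v.

(* Buyer's expected payoff when the (posterior mean) quality is q and Seller
   posts price p(q):  E_{v ~ F} [ max (v q - p q, 0) ]. *)
Definition buyer_util (R : realType) (f : R -> R) (p : R -> R) (q : R) : \bar R :=
  \int[@lebesgue_measure R]_(v in `[0, 1]) (Num.max (v * q - p q) 0 * f v)%:E.

Definition is_info_kernel (R : realType) (d : measure_display)
    (X : measurableType d) (pi : R -> probability X R) : Prop :=
  forall A : set X, measurable A -> measurable_fun [set: R] (pi ^~ A).

(* m : X -> R is (a version of) Seller's posterior mean E[q | x], i.e. the
   conditional expectation of q given the signal x under the joint law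
   mu(dq) pi(q)(dx). *)
Definition is_posterior_mean (R : realType) (d : measure_display)
    (X : measurableType d) (mu : probability R R) (pi : R -> probability X R)
    (m : X -> R) : Prop :=
  measurable_fun setT m /\
  (\int[mu]_q \int[pi q]_x (`|m x|)%:E < +oo)%E /\
  forall A : set X, measurable A ->
    (\int[mu]_q \int[pi q]_(x in A) (m x)%:E
     = \int[mu]_q \int[pi q]_(x in A) q%:E)%E.

(* Buyer's expected payoff E_{(q,v) ~ mu^B x F}[max (v q - p q, 0)] where
   mu^B = mu^S is the law of the posterior mean m(x), x ~ mu(dq) pi(q)(dx). *)
Definition buyer_payoff (R : realType) (d : measure_display)
    (X : measurableType d) (mu : probability R R) (pi : R -> probability X R)
    (m : X -> R) (f : R -> R) (p : R -> R) : \bar R :=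
  (\int[mu]_q \int[pi q]_x buyer_util f p (m x))%E.

Definition more_informative (R : realType) (ql qh : R)
    (d' : measure_display) (X' : measurableType d') (pi' : R -> probability X' R)
    (d : measure_display) (X : measurableType d) (pi : R -> probability X R) : Prop :=
  exists g : X' -> probability X R,
    (forall A : set X, measurable A -> measurable_fun [set: X'] (g ^~ A)) /\
    forall q, q \in `[ql, qh] -> forall A : set X, measurable A ->
      pi q A = (\int[pi' q]_x' g x' A)%E.

Definition full_revelation (R : realType) : R -> probability R R :=
  fun q => (dirac q : probability R R).

(* Main.v *)
Require Import Defs.
From HB Require Import structures.
From mathcomp Require Import all_boot all_order all_algebra.
From mathcomp Require Import all_classical all_reals all_analysis.
From mathcomp Require Import measurable_realfun giry.
From mathcomp Require Import ring lra.
Import Order.TTheory GRing.Theory Num.Theory.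
Import numFieldNormedType.Exports.
Local Open Scope classical_set_scope.
Local Open Scope ring_scope.
Set Implicit Arguments. Unset Strict Implicit. Unset Printing Implicit Defensive.

(* Write y = p(q)/q for the normalized price and psi for the virtual valuation.
   The first-order condition of Seller's problem is psi(y) = c/q, and psi is
   increasing where it is positive, so y decreases with q.  Buyer's payoff at q is
   U(q) = q H(y) with H(y) = E (v - y)^+, and U'(q) = W(y) with
   W = H + psi (1 - F) / psi'.  Since
     W' = (psi f / psi'^2) (r r'' + r' - 1),
   condition (3) says that W is nonincreasing in y, i.e. that U is convex in q.

   (3) => (1): the posterior mean of the garbled signal is the conditional
   expectation of the posterior mean of the finer one, so Jensen's inequality
   applies.  (1) => (2): every information structure is a garbling of full
   revelation.  (2) => (3): if (3) fails, U is strictly concave on an interval, and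
   pooling that interval at its mean strictly improves on full revelation. *)

Section real_derivatives.
Context {R : realType}.
Implicit Types (f g : R -> R) (x a b : R).

Lemma is_derive1M f g x (df dg : R) :
  is_derive x 1 f df -> is_derive x 1 g dg ->
  is_derive x 1 (fun t => f t * g t) (df * g x + f x * dg).
Proof.
move=> f_df g_dg; have := is_deriveM f_df g_dg; move/is_derive_eq; apply.
by rewrite /GRing.scale/=; ring.
Qed.

Lemma is_derive1_div f g x (df dg : R) :
  is_derive x 1 f df -> is_derive x 1 g dg -> g x != 0 ->
  is_derive x 1 (fun t => f t / g t) ((df * g x - f x * dg) / g x ^+ 2).
Proof.
move=> f_df g_dg gx0; have := is_derive1M f_df (is_deriveV gx0 g_dg).
by move/is_derive_eq; apply; rewrite /GRing.scale/=; field.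
Qed.

Lemma is_derive1_continuous f x (df : R) :
  is_derive x 1 f df -> {for x, continuous f}.
Proof. by case=> f_x _; exact/differentiable_continuous/derivable1_diffP. Qed.

Lemma is_derive1_derive1 f x : derivable f x 1 -> is_derive x 1 f (derive1 f x).
Proof. by rewrite derive1E => /derivableP. Qed.

Lemma is_derive1_val f x (df : R) : is_derive x 1 f df -> derive1 f x = df.
Proof. by case=> _ <-; rewrite derive1E. Qed.

Lemma near_derive1 f (df : R -> R) a b :
  {in `]a, b[, forall x : R, is_derive x 1 f (df x)} ->
  {in `]a, b[, forall x, \forall t \near x, df t = derive1 f t}.
Proof.
move=> f_df x x_ab; near=> t; apply/esym/is_derive1_val/f_df.
by near: t; exact: near_in_itvoo.
Unshelve. all: by end_near. Qed.

Lemma derive1_gt0_near_right f x :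
  derivable f x 1 -> 0 < derive1 f x -> \forall t \near x^'+, f x < f t.
Proof.
move=> /is_derive1_derive1/is_derive1_caratheodory[slope [slopeE slope_x slopex]].
rewrite -slopex => slope_gt0; near=> t; rewrite -subr_gt0 slopeE mulr_gt0//.
  by near: t; exact: (cvgr_gt _ (cvg_at_right_filter slope_x)).
by rewrite subr_gt0; near: t; exact: nbhs_right_gt.
Unshelve. all: by end_near. Qed.

(* The maximum of [f] on [a, y] is attained at [y]: at a maximizer [z < y] one
   would have [f z >= f a > 0], so [f] would increase to the right of [z]. *)
Lemma increasing_of_derive1_gt0_where_gt0 f a b :
  {in `[a, b], forall x, derivable f x 1} ->
  {in `[a, b], forall x, 0 < f x -> 0 < derive1 f x} -> 0 < f a ->
  {in `[a, b] &, {homo f : x y / x < y}}.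
Proof.
move=> df df_gt0 fa_gt0.
have f_gt0 : {in `[a, b], forall y, 0 < f y}.
  move=> y; rewrite in_itv/= => /andP[ay yb]; apply: (lt_le_trans fa_gt0).
  have sub_ab x : a <= x -> x <= y -> x \in `[a, b].
    by move=> ax xy; rewrite in_itv/= ax (le_trans xy).
  have [|z /[!in_itv]/= /andP[az zy] z_max] := EVT_max ay (f := f).
    by apply: derivable_within_continuous => x /[!in_itv]/= /andP[*]; exact/df/sub_ab.
  have fa_fz : f a <= f z by rewrite z_max// in_itv/= lexx.
  move: zy; rewrite le_eqVlt => /predU1P[<-//|zy]; exfalso.
  have z_ab := sub_ab _ az (ltW zy).
  have [t [zt ty fzt]] : exists t, [/\ z < t, t < y & f z < f t].
    apply: (@filter_ex _ z^'+); near=> t; split; near: t.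
    - exact: nbhs_right_gt.
    - exact: nbhs_right_lt.
    - apply: derive1_gt0_near_right; first exact: df.
      exact: df_gt0 (lt_le_trans fa_gt0 fa_fz).
  by move: fzt; rewrite ltNge z_max// in_itv/= (le_trans az (ltW zt)) ltW.
apply: gtr0_derive1_lt_cc => [x|x|].
- by move=> /subset_itv_oo_cc; exact: df.
- by move=> /subset_itv_oo_cc x_ab; exact: df_gt0 (f_gt0 _ x_ab).
- exact: derivable_within_continuous.
Unshelve. all: by end_near. Qed.

End real_derivatives.

Section parametric_curve.
Context (R : realType) (a b : R) (s u ds W : R -> R).
Hypothesis s_derive : {in `[a, b], forall y : R, is_derive y 1 s (ds y)}.
Hypothesis ds_lt0 : {in `[a, b], forall y, ds y < 0}.
Hypothesis u_derive : {in `[a, b], forall y : R, is_derive y 1 u (W y * ds y)}.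

Lemma curve_decreasing : {in `[a, b] &, {homo s : y z /~ y < z}}.
Proof.
apply: ltr0_derive1_lt_cc => [y /subset_itv_oo_cc y_ab|y /subset_itv_oo_cc y_ab|].
- by case: (s_derive y_ab).
- by rewrite (is_derive1_val (s_derive y_ab)) ds_lt0.
- by apply: derivable_within_continuous => y /s_derive[].
Qed.

Lemma curve_chord_slope y z : y \in `[a, b] -> z \in `[a, b] -> y < z ->
  exists x, [/\ x \in `[a, b], y < x < z & u z - u y = W x * (s z - s y)].
Proof.
move=> y_ab z_ab yz.
have sub_ab : {subset `[y, z] <= `[a, b]}.
  move: y_ab z_ab; rewrite !in_itv/= => /andP[ay _] /andP[_ zb] x.
  by rewrite !in_itv/= => /andP[yx xz]; rewrite (le_trans ay) ?(le_trans xz).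
have sub_ab_oo x : x \in `]y, z[ -> x \in `[a, b].
  by move=> /subset_itv_oo_cc; exact: sub_ab.
have [||x x_yz|x x_yz|x x_yz|x x_yz slopeE] :=
    @cauchy_MVT _ u (fun x => W x * ds x) s ds y z yz.
- by apply: derivable_within_continuous => x /sub_ab/u_derive[].
- by apply: derivable_within_continuous => x /sub_ab/s_derive[].
- exact/u_derive/sub_ab_oo.
- exact/s_derive/sub_ab_oo.
- exact/ltr0_neq0/ds_lt0/sub_ab_oo.
exists x; split; [exact: sub_ab_oo|by rewrite in_itv in x_yz|].
move: slopeE; rewrite mulfK ?lt_eqF ?ds_lt0 ?sub_ab_oo// => ->.
by rewrite divfK// subr_eq0 lt_eqF// curve_decreasing.
Qed.

Lemma curve_above_tangent : {in `[a, b] &, {homo W : y z /~ y <= z}} ->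
  {in `[a, b] &, forall y z, u y + W y * (s z - s y) <= u z}.
Proof.
move=> W_nincr y z y_ab z_ab; have [yz|zy|->] := ltgtP y z; last first.
- by rewrite subrr mulr0 addr0.
- have [x [x_ab /andP[zx xy] chordE]] := curve_chord_slope z_ab y_ab zy.
  have sy_lt_sz := curve_decreasing y_ab z_ab zy.
  have := W_nincr _ _ y_ab x_ab (ltW xy); nra.
- have [x [x_ab /andP[yx xz] chordE]] := curve_chord_slope y_ab z_ab yz.
  have sz_lt_sy := curve_decreasing z_ab y_ab yz.
  have := W_nincr _ _ x_ab y_ab (ltW yx); nra.
Qed.

Lemma curve_below_tangent : {in `[a, b] &, {homo W : y z / y < z}} ->
  {in `[a, b] &, forall y z, y != z -> u z < u y + W y * (s z - s y)}.
Proof.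
move=> W_incr y z y_ab z_ab; rewrite neq_lt => /orP[yz|zy].
- have [x [x_ab /andP[yx xz] chordE]] := curve_chord_slope y_ab z_ab yz.
  have sz_lt_sy := curve_decreasing z_ab y_ab yz.
  have := W_incr _ _ y_ab x_ab yx; nra.
- have [x [x_ab /andP[zx xy] chordE]] := curve_chord_slope z_ab y_ab zy.
  have sy_lt_sz := curve_decreasing y_ab z_ab zy.
  have := W_incr _ _ x_ab y_ab xy; nra.
Qed.

End parametric_curve.

(** * Integration off null sets, strict monotonicity, mixtures of kernels *)

Section off_null.
Local Open Scope ereal_scope.
Context d (T : measurableType d) (R : realType).
Variable mu : {measure set T -> \bar R}.
Implicit Types (N : set T) (f g : T -> \bar R).
Import HBNNSimple.

(* No measurability is assumed: simple functions below [f] can be cut off on [N].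
   This matters because [p], hence [buyer_util f p], is arbitrary outside [Q]. *)
Lemma ge0_le_integral_off_null N f g : measurable N -> mu N = 0 ->
  (forall x, 0 <= f x) -> (forall x, 0 <= g x) ->
  (forall x, ~ N x -> f x <= g x) -> \int[mu]_x f x <= \int[mu]_x g x.
Proof.
move=> mN N0 f_ge0 g_ge0 f_le_g; rewrite !ge0_integralTE//.
apply: ge_ereal_sup => _ [h /= h_le_f <-].
have mNC : measurable (~` N) by exact: measurableC.
apply: ereal_sup_ubound; exists (proj_nnsfun h mNC).
  move=> x /=; rewrite mindicE; have [/set_mem Nx|/negP Nx] := boolP (x \in ~` N).
    by rewrite mulr1 (le_trans (h_le_f x))// f_le_g.
  by rewrite mulr0.
rewrite -!integralT_nnsfun -mrestrict.
rewrite [RHS](@ge0_negligible_integral _ _ _ mu setT N)//=; last 2 first.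
  exact/measurable_EFinP.
  by move=> x _; rewrite lee_fin.
rewrite setTD [RHS]integral_mkcond; apply: eq_integral => x _.
by rewrite /= !patchE; case: ifP.
Qed.

Lemma eq_integral_off_null N f g : measurable N -> mu N = 0 ->
  (forall x, ~ N x -> f x = g x) -> \int[mu]_x f x = \int[mu]_x g x.
Proof.
move=> mN N0 f_eq_g; rewrite integralE [RHS]integralE.
by congr (_ - _); apply/eqP; rewrite eq_le; apply/andP; split;
  apply: (ge0_le_integral_off_null mN N0) => // x Nx;
  rewrite ?funeposE ?funenegE f_eq_g.
Qed.

Lemma integral_setID (A D : set T) f : measurable A -> measurable D ->
  measurable_fun D f ->
  \int[mu]_(x in D) f x = \int[mu]_(x in D `&` A) f x + \int[mu]_(x in D `\` A) f x.
Proof.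
move=> mA mD mf; rewrite -integral_setU ?setUIDK//.
- exact: measurableI.
- exact: measurableD.
- by apply/disj_setPS => x [[_ Ax] []].
Qed.

Lemma lt_integral (D B : set T) (f g : T -> R) : measurable D ->
  measurable B -> B `<=` D ->
  mu.-integrable D (EFin \o f) -> mu.-integrable D (EFin \o g) ->
  (forall x, D x -> f x <= g x)%R -> (forall x, B x -> f x < g x)%R ->
  0 < mu B -> \int[mu]_(x in D) (f x)%:E < \int[mu]_(x in D) (g x)%:E.
Proof.
move=> mD mB BD f_int g_int f_le_g f_lt_g.
have gap_ge0 x : D x -> 0 <= (g x)%:E - (f x)%:E.
  by move=> Dx; rewrite -EFinB lee_fin subr_ge0 f_le_g.
move=> muB_gt0; rewrite -sube_gt0 -integralB_EFin// lt_neqAle integral_ge0// andbT.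
apply: contraTneq muB_gt0 => gap0; rewrite -leNgt.
have /(ae_eq_integral_abs _ mD)[] : \int[mu]_(x in D) `|(g x)%:E - (f x)%:E| = 0.
- by rewrite gap0; apply: eq_integral => x /set_mem Dx; rewrite gee0_abs// gap_ge0.
- exact/(measurable_int mu)/(integrableB mD).
move=> N [mN N0 gapN]; rewrite -N0 le_measure ?inE// => x Bx.
apply: gapN => /= /(_ (BD _ Bx)); apply/eqP.
by rewrite -EFinB gt_eqF// lte_fin subr_gt0 f_lt_g.
Qed.

End off_null.

Section mixture.
Local Open Scope ereal_scope.
Context d1 d2 (T : measurableType d1) (X : measurableType d2) (R : realType).
Variables (mu : giry T R) (k : T -> probability X R).
Hypothesis k_meas : forall A, measurable A -> measurable_fun setT (k ^~ A).

Definition mixture : giry X R :=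
  giry_bind mu (f := fun t => k t : giry X R)
    (measurable_giry_codensity measurableT k_meas).

Lemma ge0_integral_mixture (h : X -> \bar R) : measurable_fun setT h ->
  (forall x, 0 <= h x) -> \int[mixture]_x h x = \int[mu]_t \int[k t]_x h x.
Proof. exact: giry_int_bind. Qed.

Lemma mixtureE (A : set X) : measurable A -> mixture A = \int[mu]_t k t A.
Proof.
move=> mA; rewrite -[in LHS](setIT A) -[LHS]integral_indic// ge0_integral_mixture.
- by apply: eq_integral => t _; rewrite integral_indic// setIT.
- exact/measurable_EFinP/measurable_indic.
- by move=> x; rewrite lee_fin.
Qed.

Lemma integral_mixture (h : X -> \bar R) : mixture.-integrable setT h ->
  \int[mixture]_x h x = \int[mu]_t \int[k t]_x h x.
Proof.
move=> h_int; have mh := measurable_int _ h_int.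
have mp := measurable_funepos mh; have mn := measurable_funeneg mh.
have part_int (g : X -> \bar R) : measurable_fun setT g -> (forall x, 0 <= g x) ->
    \int[mixture]_x g x < +oo -> mu.-integrable setT (fun t => \int[k t]_x g x).
  move=> mg g_ge0 g_lty; apply/integrableP; split.
    exact: measurable_fun_integral_kernel.
  rewrite (eq_integral (fun t => \int[k t]_x g x)) -?ge0_integral_mixture// => t _.
  by rewrite gee0_abs// integral_ge0.
rewrite [LHS]integralE !ge0_integral_mixture// -integralB//.
- by apply: eq_integral => t _; rewrite [RHS]integralE.
- by apply: part_int => //; exact: integral_funepos_lt_pinfty.
- by apply: part_int => //; exact: integral_funeneg_lt_pinfty.
Qed.

Lemma mixture_null (A : set X) (g h : X -> \bar R) : measurable A ->
  mixture A = 0 -> (forall x, ~ A x -> g x = h x) ->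
  \int[mu]_t \int[k t]_x g x = \int[mu]_t \int[k t]_x h x.
Proof.
move=> mA A0 g_eq_h.
have /(ae_eq_integral_abs _ measurableT)[|N [mN N0 kA_N]] :
    \int[mu]_t `|k t A| = 0.
- by rewrite -A0 mixtureE//; apply: eq_integral => t _; rewrite gee0_abs.
- exact: k_meas.
apply: (eq_integral_off_null mN N0) => t Nt.
apply: (eq_integral_off_null mA _ g_eq_h).
by apply: contra_notP Nt => kA_neq0; apply: kA_N => /= /(_ I).
Qed.

End mixture.

Section reweight.
Local Open Scope ereal_scope.
Context d (T : measurableType d) (R : realType) (w : T -> R) (B : R).
Hypothesis B_gt0 : (0 < B)%R.
Hypothesis w_meas : measurable_fun setT w.
Hypothesis w_itv : forall t, (0 <= w t <= B)%R.

Let weight_ge0 t : (0 <= w t / B)%R.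
Proof. by have /andP[w_ge0 _] := w_itv t; rewrite divr_ge0// ltW. Qed.

Definition weighted_dirac (t : T) : set T -> \bar R :=
  mscale (NngNum (weight_ge0 t)) \d_t.

HB.instance Definition _ t := Measure.on (weighted_dirac t).

Let weighted_dirac_setT t : weighted_dirac t setT <= 1.
Proof.
rewrite /weighted_dirac /mscale/= diracT mule1 lee_fin ler_pdivrMr// mul1r.
by case/andP: (w_itv t).
Qed.

HB.instance Definition _ t := Measure_isSubProbability.Build _ _ _
  (weighted_dirac t) (weighted_dirac_setT t).

Let weighted_dirac_kernel (A : set T) : measurable A ->
  measurable_fun setT (fun t => (weighted_dirac t : giry T R) A).
Proof.
move=> mA; apply: emeasurable_funM; last exact: measurable_fun_dirac.
by apply/measurable_EFinP; exact: measurable_funM.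
Qed.

(* [giry] is the type of subprobabilities, whence the normalization by [B]. *)
Definition reweight (mu : giry T R) : giry T R :=
  giry_bind mu (measurable_giry_codensity measurableT weighted_dirac_kernel).

Lemma integral_reweight (mu : giry T R) (h : T -> \bar R) :
  measurable_fun setT h -> (forall t, 0 <= h t) ->
  B%:E * \int[reweight mu]_t h t = \int[mu]_t ((w t)%:E * h t).
Proof.
move=> mh h_ge0; have := giry_int_bind mu
  (measurable_giry_codensity measurableT weighted_dirac_kernel) mh h_ge0.
have int_weighted_dirac t :
    \int[weighted_dirac t]_s h s = (w t / B)%:E * h t.
  by rewrite ge0_integral_mscale// integral_dirac// diracT mul1e.
rewrite /giry_int => ->; under eq_integral do rewrite int_weighted_dirac.
rewrite -ge0_integralZl//.
- by apply: eq_integral => t _; rewrite muleA -EFinM mulrC divfK// gt_eqF.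
- by apply: emeasurable_funM => //; apply/measurable_EFinP; exact: measurable_funM.
- by move=> t _; rewrite mule_ge0// lee_fin.
- by rewrite lee_fin ltW.
Qed.

End reweight.

Section weighted_kernel.
Local Open Scope ereal_scope.
Context d1 d2 (T : measurableType d1) (X : measurableType d2) (R : realType).
Variables (mu : giry T R) (nu : giry X R) (k : T -> probability X R).
Variables (w : T -> R) (v : X -> R) (B : R).
Hypothesis k_meas : forall A, measurable A -> measurable_fun setT (k ^~ A).
Hypotheses (w_meas : measurable_fun setT w) (v_meas : measurable_fun setT v).
Hypothesis B_gt0 : (0 < B)%R.
Hypothesis w_itv : forall t, (0 <= w t <= B)%R.
Hypothesis v_itv : forall x, (0 <= v x <= B)%R.
Hypothesis v_integral : forall A, measurable A ->
  \int[nu]_(x in A) (v x)%:E = \int[mu]_t ((w t)%:E * k t A).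

(* Up to the factor [B], both sides integrate [h] against measures, which coincide
   on sets by assumption. *)
Lemma weighted_integral_kernel (h : X -> \bar R) :
  measurable_fun setT h -> (forall x, 0 <= h x) ->
  \int[nu]_x ((v x)%:E * h x) = \int[mu]_t ((w t)%:E * \int[k t]_x h x).
Proof.
move=> mh h_ge0; pose wmu := reweight B_gt0 w_meas w_itv mu.
have -> : \int[mu]_t ((w t)%:E * \int[k t]_x h x) =
    B%:E * \int[mixture wmu k_meas]_x h x.
  rewrite ge0_integral_mixture// integral_reweight//.
    exact: measurable_fun_integral_kernel.
  by move=> t; exact: integral_ge0.
rewrite -(integral_reweight B_gt0 v_meas v_itv)//; congr (_ * _).
apply: eq_measure_integral => A mA _.
have B_fin : B%:E \is a fin_num by [].
apply: (inc_inj (lee_pmul2l B_fin _)); first by rewrite lte_fin.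
have -> : B%:E * mixture wmu k_meas A = \int[mu]_t ((w t)%:E * k t A).
  by rewrite mixtureE// integral_reweight//; exact: k_meas.
rewrite -v_integral// -[X in _ * _ X](setIT A) -integral_indic//.
rewrite (integral_reweight B_gt0 v_meas v_itv).
- by rewrite [RHS]integral_mkcond; apply: eq_integral => x _; rewrite epatch_indic.
- exact/measurable_EFinP/measurable_indic.
- by move=> x; rewrite lee_fin.
Qed.

End weighted_kernel.

(* Jensen's inequality without conditional expectations: the tangent inequality
   [u + s * (M' - M) <= u'] is integrated against the joint law
   [nu' (dx') g x' (dx)], under which [M] is the conditional expectation of [M']
   given [x], so that the terms in [s] cancel. *)
Section tangent_inequality.
Local Open Scope ereal_scope.
Context (R : realType) d d' (X : measurableType d) (X' : measurableType d').
Variables (nu : giry X R) (nu' : giry X' R) (g : X' -> probability X R).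
Variables (u s M : X -> \bar R) (u' M' : X' -> \bar R).
Hypothesis g_meas : forall A, measurable A -> measurable_fun setT (g ^~ A).
Hypotheses (u_meas : measurable_fun setT u) (u_ge0 : forall x, 0 <= u x).
Hypotheses (s_meas : measurable_fun setT s) (s_ge0 : forall x, 0 <= s x).
Hypotheses (M_meas : measurable_fun setT M) (M_ge0 : forall x, 0 <= M x).
Hypotheses (u'_meas : measurable_fun setT u') (u'_ge0 : forall x', 0 <= u' x').
Hypotheses (M'_meas : measurable_fun setT M') (M'_ge0 : forall x', 0 <= M' x').
Hypothesis tangent : forall x x', u x + M' x' * s x <= u' x' + M x * s x.

Let Ms_meas : measurable_fun setT (fun x => M x * s x).
Proof. exact: emeasurable_funM. Qed.

Let Ms_ge0 x : 0 <= M x * s x. Proof. exact: mule_ge0. Qed.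

Lemma integral_tangent (x' : X') :
  \int[g x']_x u x + M' x' * \int[g x']_x s x <=
  u' x' + \int[g x']_x (M x * s x).
Proof.
have -> : u' x' = \int[g x']_x (cst (u' x') x).
  by rewrite integral_cst// [X in _ * X]probability_setT mule1.
have M's_meas : measurable_fun setT (fun x => M' x' * s x).
  by apply: emeasurable_funM s_meas; exact: measurable_cst.
have M's_ge0 x : 0 <= M' x' * s x by exact: mule_ge0.
rewrite -ge0_integralZl// -!ge0_integralD//; last by move=> x _; exact: u'_ge0.
apply: ge0_le_integral => //.
- by move=> x _; exact: adde_ge0.
- exact: emeasurable_funD.
- exact: emeasurable_funD.
Qed.

Hypothesis nuE : forall h : X -> \bar R, measurable_fun setT h ->
  (forall x, 0 <= h x) -> \int[nu]_x h x = \int[nu']_x' \int[g x']_x h x.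
Hypothesis Ms_integral :
  \int[nu]_x (M x * s x) = \int[nu']_x' (M' x' * \int[g x']_x s x).
Hypothesis Ms_lty : \int[nu]_x (M x * s x) < +oo.

Lemma le_integral_of_tangent : \int[nu]_x u x <= \int[nu']_x' u' x'.
Proof.
have Ms_fin : \int[nu]_x (M x * s x) \is a fin_num.
  by rewrite ge0_fin_numE// integral_ge0.
have g_int (h : X -> \bar R) : measurable_fun setT h -> (forall x, 0 <= h x) ->
    measurable_fun setT (fun x' => \int[g x']_x h x).
  by move=> h_meas h_ge0; exact: measurable_fun_integral_kernel.
have g_ge0 (h : X -> \bar R) x' : (forall x, 0 <= h x) -> 0 <= \int[g x']_x h x.
  by move=> h_ge0; exact: integral_ge0.
have M's_meas : measurable_fun setT (fun x' => M' x' * \int[g x']_x s x).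
  by apply: emeasurable_funM => //; exact: g_int.
have M's_ge0 x' : 0 <= M' x' * \int[g x']_x s x by rewrite mule_ge0 ?g_ge0.
rewrite -(leeD2rE _ _ Ms_fin) [X in _ + X <= _]Ms_integral !nuE//.
have [int_u int_Ms] := (g_int _ u_meas u_ge0, g_int _ Ms_meas Ms_ge0).
rewrite -(ge0_integralD nu' measurableT (fun x' _ => g_ge0 u x' u_ge0) int_u
  (fun x' _ => M's_ge0 x') M's_meas).
rewrite -(ge0_integralD nu' measurableT (fun x' _ => u'_ge0 x') u'_meas
  (fun x' _ => g_ge0 _ x' Ms_ge0) int_Ms).
apply: ge0_le_integral => //.
- by move=> x' _; rewrite adde_ge0 ?g_ge0.
- exact: emeasurable_funD.
- exact: emeasurable_funD.
- by move=> x' _; exact: integral_tangent.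
Qed.

End tangent_inequality.

(* Posterior means lie in the support of the prior only almost surely; clamping
   them makes this true everywhere without changing their law. *)
Definition clamp (R : realType) (a b t : R) : R := Num.max a (Num.min b t).

Section clamp.
Context (R : realType) (a b : R).
Hypothesis ab : a < b.

Lemma clamp_in t : clamp a b t \in `[a, b].
Proof. by rewrite in_itv/= /clamp le_max lexx/= ge_max ge_min lexx (ltW ab). Qed.

Lemma clamp_id t : t \in `[a, b] -> clamp a b t = t.
Proof. by rewrite in_itv/= /clamp => /andP[a_t t_b]; rewrite min_r// max_r. Qed.

Lemma clamp_nondecreasing : {homo clamp a b : x y / x <= y}.
Proof.
move=> x y xy; rewrite /clamp ge_max le_max lexx/= le_max; apply/orP; right.
by rewrite le_min !ge_min lexx xy orbT.
Qed.

Lemma measurable_clamp : measurable_fun setT (clamp a b).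
Proof. exact: nondecreasing_measurable clamp_nondecreasing. Qed.

Lemma measurable_clamp_comp (h : R -> R) :
  {in `[a, b] &, {homo h : x y / x <= y}} -> measurable_fun setT (h \o clamp a b).
Proof.
move=> h_ndecr; apply: nondecreasing_measurable => // x y xy /=.
by apply: h_ndecr; [exact: clamp_in|exact: clamp_in|exact: clamp_nondecreasing].
Qed.

End clamp.

Lemma eq_integral_supported d (T : measurableType d) (R : realType)
    (P : probability T R) (S : set T) (g h : T -> \bar R) : measurable S ->
  P S = 1%E -> (forall t, S t -> g t = h t) ->
  (\int[P]_t g t = \int[P]_t h t)%E.
Proof.
move=> mS PS1 g_eq_h.
have PSC0 : P (~` S) = 0%E by rewrite probability_setC// PS1 subee.
by apply: (eq_integral_off_null (measurableC mS) PSC0) => t /contrapT/g_eq_h.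
Qed.

(** * Posterior means *)

Section posterior.
Local Open Scope ereal_scope.
Context (R : realType) (a b : R) (mu : probability R R)
  d (X : measurableType d) (pi : R -> probability X R) (m : X -> R).
Hypotheses (a_gt0 : (0 < a)%R) (ab : (a < b)%R).
Hypothesis mu_supp : mu `[a, b]%classic = 1.
Hypothesis pi_kernel : is_info_kernel pi.
Hypothesis m_post : is_posterior_mean mu pi m.
Local Notation nu := (mixture mu pi_kernel).
Local Notation kap := (clamp a b).

Let m_meas : measurable_fun setT m. Proof. by case: m_post. Qed.

Let kap_itv t : (a <= kap t <= b)%R.
Proof. by have := clamp_in ab t; rewrite in_itv. Qed.

Let kap_ge0 t : (0 <= kap t)%R.
Proof. by have /andP[+ _] := kap_itv t; apply: le_trans; exact: ltW. Qed.

Let preimage_measurable (B : set R) : measurable B -> measurable (m @^-1` B).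
Proof. by move=> mB; rewrite -[_ @^-1` _]setTI; exact: m_meas. Qed.

Let weighted_prior_measurable A : measurable A ->
  measurable_fun setT (fun q => (kap q)%:E * pi q A).
Proof.
move=> mA; apply: emeasurable_funM; last exact: pi_kernel.
by apply/measurable_EFinP; exact: measurable_clamp.
Qed.

Lemma posterior_mean_integrable : nu.-integrable setT (EFin \o m).
Proof.
apply/integrableP; split; first exact/measurable_EFinP.
rewrite ge0_integral_mixture//; first by case: m_post => _ [].
by apply/measurable_EFinP; exact: measurableT_comp.
Qed.

Lemma integral_posterior_mean (A : set X) : measurable A ->
  \int[nu]_(x in A) (m x)%:E = \int[mu]_q ((kap q)%:E * pi q A).
Proof.
move=> mA; rewrite integral_mkcond integral_mixture; last first.
  apply/(integrable_mkcond _ mA)/(integrableS measurableT mA) => //.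
  exact: posterior_mean_integrable.
under eq_integral do rewrite -integral_mkcond.
have [_ [_ ->//]] := m_post.
apply: (eq_integral_supported _ mu_supp) => // q qQ.
by rewrite integral_cst// clamp_id.
Qed.

Lemma integral_quality_bounds (A : set X) : measurable A ->
  a%:E * nu A <= \int[mu]_q ((kap q)%:E * pi q A) <= b%:E * nu A.
Proof.
move=> mA; have b_ge0 : (0 <= b)%R by exact/ltW/(lt_trans a_gt0).
have piA_meas := pi_kernel mA; have w_meas := weighted_prior_measurable mA.
have cst_meas (r : R) : measurable_fun setT (fun q => r%:E * pi q A).
  exact: measurable_funeM.
have w_ge0 (r : R) q : (0 <= r)%R -> 0 <= r%:E * pi q A.
  by move=> r_ge0; rewrite mule_ge0// lee_fin.
rewrite mixtureE// -!ge0_integralZl// ?lee_fin ?(ltW a_gt0)//.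
apply/andP; split; apply: ge0_le_integral => //.
- by move=> q _; exact/w_ge0/ltW.
- by move=> q _; rewrite lee_wpmul2r// lee_fin; case/andP: (kap_itv q).
- by move=> q _; exact: w_ge0.
- by move=> q _; rewrite lee_wpmul2r// lee_fin; case/andP: (kap_itv q).
Qed.

Let m_int A : measurable A -> nu.-integrable A (EFin \o m).
Proof. by move=> mA; exact: integrableS posterior_mean_integrable. Qed.

Let cst_int A r : measurable A -> nu.-integrable A (EFin \o cst r).
Proof. by move=> mA; exact: finite_measure_integrable_cst. Qed.

Lemma posterior_mean_lt_null : nu (m @^-1` `]-oo, a[) = 0.
Proof.
set A := m @^-1` _; have mA : measurable A by exact: preimage_measurable.
apply/eqP; rewrite eq_le measure_ge0 andbT leNgt; apply/negP => nuA_gt0.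
have m_lt_a x : A x -> (m x < a)%R by rewrite /A/= in_itv.
have := lt_integral mA mA (@subset_refl _ A) (m_int mA) (cst_int a mA)
  (fun x Ax => ltW (m_lt_a x Ax)) m_lt_a nuA_gt0.
rewrite integral_posterior_mean// ltNge.
by have /andP[+ _] := integral_quality_bounds mA; rewrite -integral_cst// => ->.
Qed.

Lemma posterior_mean_gt_null : nu (m @^-1` `]b, +oo[) = 0.
Proof.
set A := m @^-1` _; have mA : measurable A by exact: preimage_measurable.
apply/eqP; rewrite eq_le measure_ge0 andbT leNgt; apply/negP => nuA_gt0.
have b_lt_m x : A x -> (b < m x)%R by rewrite /A/= in_itv/= andbT.
have := lt_integral mA mA (@subset_refl _ A) (cst_int b mA) (m_int mA)
  (fun x Ax => ltW (b_lt_m x Ax)) b_lt_m nuA_gt0.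
rewrite integral_posterior_mean// ltNge.
by have /andP[_ +] := integral_quality_bounds mA; rewrite -integral_cst// => ->.
Qed.

Lemma posterior_mean_off_support_null : nu (m @^-1` ~` `[a, b]) = 0.
Proof.
have -> : m @^-1` (~` `[a, b]) = m @^-1` `]-oo, a[ `|` m @^-1` `]b, +oo[.
  by rewrite -preimage_setU; congr (m @^-1` _); rewrite setCitv.
rewrite measureU0.
- exact: posterior_mean_lt_null.
- exact: preimage_measurable.
- exact: preimage_measurable.
- exact: posterior_mean_gt_null.
Qed.

Lemma clamp_posterior_mean_integral (A : set X) : measurable A ->
  \int[nu]_(x in A) (kap (m x))%:E = \int[mu]_q ((kap q)%:E * pi q A).
Proof.
move=> mA; rewrite -integral_posterior_mean//; apply: ae_eq_integral => //.
- apply/measurable_EFinP/measurable_funTS.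
  by apply: measurableT_comp m_meas; exact: measurable_clamp.
- exact/measurable_EFinP/measurable_funTS.
exists (m @^-1` ~` `[a, b]); split.
- exact/preimage_measurable/measurableC.
- exact: posterior_mean_off_support_null.
move=> x; apply: contra_not => /= mx_ab _.
by rewrite clamp_id//; exact: contrapT.
Qed.

Lemma posterior_mean_integral (h : X -> \bar R) : measurable_fun setT h ->
  (forall x, 0 <= h x) ->
  \int[nu]_x ((kap (m x))%:E * h x) = \int[mu]_q ((kap q)%:E * \int[pi q]_x h x).
Proof.
have kap_0b t : (0 <= kap t <= b)%R by rewrite kap_ge0; case/andP: (kap_itv t).
apply: (weighted_integral_kernel (B := b) pi_kernel) => //.
- exact: measurable_clamp.
- by apply: measurableT_comp m_meas; exact: measurable_clamp.
- exact: lt_trans ab.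
- exact: clamp_posterior_mean_integral.
Qed.

Lemma posterior_payoff (g g_kap : R -> \bar R) :
  (forall t, t \in `[a, b] -> g t = g_kap t) ->
  measurable_fun setT (g_kap \o kap) -> (forall t, 0 <= g_kap (kap t)) ->
  \int[mu]_q \int[pi q]_x g (m x) = \int[nu]_x g_kap (kap (m x)).
Proof.
move=> g_eq g_meas g_ge0; rewrite ge0_integral_mixture//; last first.
  exact: (measurableT_comp g_meas m_meas).
apply: (mixture_null (k_meas := pi_kernel) _ posterior_mean_off_support_null).
  exact/preimage_measurable/measurableC.
by move=> x /contrapT/= mx_ab; rewrite clamp_id// g_eq.
Qed.

End posterior.

Section garbling.
Local Open Scope ereal_scope.
Context (R : realType) (a b : R) (mu : probability R R)
  d d' (X : measurableType d) (X' : measurableType d')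
  (pi : R -> probability X R) (pi' : R -> probability X' R)
  (m : X -> R) (m' : X' -> R) (g : X' -> probability X R).
Hypotheses (a_gt0 : (0 < a)%R) (ab : (a < b)%R).
Hypothesis mu_supp : mu `[a, b]%classic = 1.
Hypotheses (pi_kernel : is_info_kernel pi) (pi'_kernel : is_info_kernel pi').
Hypothesis m_post : is_posterior_mean mu pi m.
Hypothesis m'_post : is_posterior_mean mu pi' m'.
Hypothesis g_meas : forall A, measurable A -> measurable_fun setT (g ^~ A).
Hypothesis pi_garbled : forall q, q \in `[a, b] -> forall A, measurable A ->
  pi q A = \int[pi' q]_x' g x' A.
Local Notation nu := (mixture mu pi_kernel).
Local Notation nu' := (mixture mu pi'_kernel).
Local Notation kap := (clamp a b).

Lemma integral_garbled (h : X -> \bar R) (q : R) : q \in `[a, b] ->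
  measurable_fun setT h -> (forall x, 0 <= h x) ->
  \int[pi q]_x h x = \int[pi' q]_x' \int[g x']_x h x.
Proof.
move=> qQ mh h_ge0.
rewrite -(ge0_integral_mixture (pi' q : giry X' R) g_meas)//.
apply: eq_measure_integral => A mA _.
exact: etrans (pi_garbled qQ mA) (esym (mixtureE (pi' q : giry X' R) g_meas mA)).
Qed.

Lemma garbling_integral (h : X -> \bar R) : measurable_fun setT h ->
  (forall x, 0 <= h x) -> \int[nu]_x h x = \int[nu']_x' \int[g x']_x h x.
Proof.
move=> mh h_ge0; rewrite !ge0_integral_mixture//.
- by apply: (eq_integral_supported _ mu_supp) => // q qQ; exact: integral_garbled.
- exact: measurable_fun_integral_kernel.
- by move=> x'; exact: integral_ge0.
Qed.

Lemma garbling_posterior_integral (h : X -> \bar R) : measurable_fun setT h ->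
  (forall x, 0 <= h x) ->
  \int[nu]_x ((kap (m x))%:E * h x) =
  \int[nu']_x' ((kap (m' x'))%:E * \int[g x']_x h x).
Proof.
move=> mh h_ge0.
rewrite (posterior_mean_integral a_gt0 ab mu_supp pi_kernel m_post)//.
rewrite (posterior_mean_integral a_gt0 ab mu_supp pi'_kernel m'_post).
- by apply: (eq_integral_supported _ mu_supp) => // q qQ; rewrite integral_garbled.
- exact: measurable_fun_integral_kernel.
- by move=> x'; exact: integral_ge0.
Qed.

Variables U D : R -> R.
Hypotheses (U_ge0 : {in `[a, b], forall t, (0 <= U t)%R})
           (D_ge0 : {in `[a, b], forall t, (0 <= D t)%R}).
Hypothesis U_meas : measurable_fun setT (U \o kap).
Hypothesis D_ndecr : {in `[a, b] &, {homo D : s t / (s <= t)%R}}.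
Hypothesis tangent : {in `[a, b] &, forall t s, (U t + D t * (s - t) <= U s)%R}.

Let kap_in t : kap t \in `[a, b]. Proof. exact: clamp_in. Qed.

Let kap_itv t : (0 <= kap t <= b)%R.
Proof.
have := kap_in t; rewrite in_itv/= => /andP[a_kap ->].
by rewrite (le_trans (ltW a_gt0)).
Qed.

Let m_meas : measurable_fun setT m. Proof. by case: m_post. Qed.

Let clamped_mean_measurable d0 (X0 : measurableType d0) (m0 : X0 -> R) :
  measurable_fun setT m0 -> measurable_fun setT (fun x => (kap (m0 x))%:E).
Proof.
move=> m0_meas; apply/measurable_EFinP.
by apply: measurableT_comp m0_meas; exact: measurable_clamp.
Qed.

Let slope_measurable : measurable_fun setT (fun x => (D (kap (m x)))%:E).
Proof.
apply/measurable_EFinP.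
exact: measurableT_comp (measurable_clamp_comp ab D_ndecr) m_meas.
Qed.

Let mean_slope_lty : \int[nu]_x ((kap (m x))%:E * (D (kap (m x)))%:E) < +oo.
Proof.
have b_in : b \in `[a, b] by rewrite in_itv/= lexx ltW.
have cst_lty := integrable_lty measurableT
  (finite_measure_integrable_cst nu (b * D b)%R measurableT).
apply: le_lt_trans cst_lty; apply: ge0_le_integral => //=.
- by move=> x _; rewrite -EFinM lee_fin mulr_ge0 ?D_ge0//; case/andP: (kap_itv (m x)).
- exact: emeasurable_funM (clamped_mean_measurable m_meas) slope_measurable.
- by apply/measurable_EFinP; exact: measurable_cst.
move=> x _; have /andP[kap_ge0 kap_le] := kap_itv (m x).
by rewrite -EFinM lee_fin ler_pM ?D_ge0 ?D_ndecr.
Qed.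

Lemma le_integral_garbled :
  \int[nu]_x (U (kap (m x)))%:E <= \int[nu']_x' (U (kap (m' x')))%:E.
Proof.
have [m'_meas _] := m'_post.
apply: (le_integral_of_tangent (g := g) (s := fun x => (D (kap (m x)))%:E)
  (M := fun x => (kap (m x))%:E) (M' := fun x' => (kap (m' x'))%:E)) => //.
- by apply/measurable_EFinP; exact: measurableT_comp U_meas m_meas.
- by move=> x; rewrite lee_fin U_ge0.
- by move=> x; rewrite lee_fin D_ge0.
- exact: clamped_mean_measurable.
- by move=> x; rewrite lee_fin; case/andP: (kap_itv (m x)).
- by apply/measurable_EFinP; exact: measurableT_comp U_meas m'_meas.
- by move=> x; rewrite lee_fin U_ge0.
- exact: clamped_mean_measurable.
- by move=> x; rewrite lee_fin; case/andP: (kap_itv (m' x)).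
- move=> x x'; rewrite -!EFinM -!EFinD lee_fin.
  by have := tangent (kap_in (m x)) (kap_in (m' x')); lra.
- exact: garbling_integral.
- by apply: garbling_posterior_integral => // x; rewrite lee_fin D_ge0.
Qed.

End garbling.

(** * Deterministic signals and pooling *)

Section deterministic_signal.
Local Open Scope ereal_scope.
Context (R : realType) (mu : probability R R) (s : R -> R).

Lemma dirac_kernel : measurable_fun setT s ->
  is_info_kernel (fun q => (dirac (s q) : probability R R)).
Proof.
by move=> s_meas A mA; exact: measurableT_comp (measurable_fun_dirac mA) s_meas.
Qed.

Lemma integral_dirac_signal (A : set R) (h : R -> R) : measurable A ->
  measurable_fun setT h ->
  \int[mu]_q \int[dirac (s q)]_(x in A) (h x)%:E =
  \int[mu]_(q in s @^-1` A) (h (s q))%:E.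
Proof.
move=> mA h_meas; rewrite [RHS]integral_mkcond; apply: eq_integral => q _.
rewrite integral_dirac//; last exact/measurable_EFinP/measurable_funTS.
rewrite diracE patchE -[q \in _]/(s q \in A).
by case: ifP => _; rewrite ?mul1e ?mul0e.
Qed.

Lemma dirac_posterior_mean : mu.-integrable setT (EFin \o s) ->
  (forall A, measurable A ->
    \int[mu]_(q in s @^-1` A) (s q)%:E = \int[mu]_(q in s @^-1` A) q%:E) ->
  is_posterior_mean mu (fun q => (dirac (s q) : probability R R)) id.
Proof.
move=> /integrableP[_ s_lty] s_mean; split; first exact: measurable_id.
split.
  have := @integral_dirac_signal setT (fun x => `|x|%R) measurableT.
  by rewrite preimage_setT => ->//; exact: normr_measurable.
move=> A mA; rewrite (integral_dirac_signal mA (@measurable_id _ _ _)) s_mean//.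
rewrite integral_mkcond; apply: eq_integral => q _.
rewrite integral_cst// patchE -[q \in _]/(s q \in A) [X in _ * X]diracE.
by case: ifP => _; rewrite ?mule1 ?mule0.
Qed.

End deterministic_signal.

Definition pool (R : realType) (I : set R) (qbar q : R) : R :=
  if q \in I then qbar else q.

Section pooling.
Local Open Scope ereal_scope.
Context (R : realType) (mu : probability R R) (I : set R) (qbar : R).
Hypothesis mI : measurable I.
Hypothesis mu_int : mu.-integrable setT (EFin \o @id R).
Hypothesis qbarE : \int[mu]_(q in I) q%:E = qbar%:E * mu I.
Local Notation pool := (pool I qbar).

Lemma pool_in (q : R) : I q -> pool q = qbar.
Proof. by move=> Iq; rewrite /pool mem_set. Qed.

Lemma pool_notin (q : R) : ~ I q -> pool q = q.
Proof. by move=> Iq; rewrite /pool memNset. Qed.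

Lemma measurable_pool : measurable_fun setT pool.
Proof.
apply: measurable_fun_ifT => //; apply: (measurable_fun_bool true).
by rewrite setTI preimage_mem_true.
Qed.

Lemma pool_integrable : mu.-integrable setT (EFin \o pool).
Proof.
have bound_int := integrableD measurableT
  (finite_measure_integrable_cst mu `|qbar|%R measurableT) (integrable_norm mu_int).
apply: le_integrable bound_int => //.
  by apply/measurable_EFinP; exact: measurable_pool.
move=> q _; rewrite lee_fin/= [leRHS]ger0_norm ?addr_ge0// /pool.
by case: ifP => _; rewrite ?lerDl ?lerDr.
Qed.

Lemma pool_posterior_mean :
  is_posterior_mean mu (fun q => (dirac (pool q) : probability R R)) id.
Proof.
apply: (dirac_posterior_mean pool_integrable) => A mA.
set J := pool @^-1` A.
have mJ : measurable J by rewrite -[J]setTI; exact: measurable_pool.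
rewrite [LHS](integral_setID _ mI)//; last first.
  by apply/measurable_EFinP/measurable_funTS; exact: measurable_pool.
rewrite [RHS](integral_setID _ mI)//.
congr (_ + _); last first.
  by apply: eq_integral => q /set_mem[_ Iq]; rewrite pool_notin.
have [A_qbar|A_qbar] := pselect (A qbar); last first.
  rewrite (_ : J `&` I = set0) ?integral_set0//.
  by rewrite -subset0 => q [+ Iq]; rewrite /J/= pool_in.
have -> : J `&` I = I by apply/setIidr => q Iq; rewrite /J/= pool_in.
rewrite qbarE -integral_cst//; apply: eq_integral => q /set_mem Iq.
by rewrite pool_in.
Qed.

Let int_on_I (h : R -> R) :
  mu.-integrable setT (EFin \o h) -> mu.-integrable I (EFin \o h).
Proof. exact: (integrableS measurableT mI (@subsetT _ I)). Qed.

Let cst_int_I r : mu.-integrable I (EFin \o cst r).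
Proof. exact: finite_measure_integrable_cst. Qed.

Let deviation_int : mu.-integrable I (EFin \o (fun q => q - qbar)%R).
Proof.
have := integrableB mI (int_on_I mu_int) (cst_int_I qbar).
exact: eq_integrable.
Qed.

Lemma integral_deviation (slope : R) :
  \int[mu]_(q in I) (slope * (q - qbar))%:E = 0.
Proof.
under eq_integral do rewrite EFinM.
have int_qbar : \int[mu]_(q in I) qbar%:E = qbar%:E * mu I by exact: integral_cst.
rewrite integralZl// integralB_EFin//; [|exact: int_on_I mu_int|exact: cst_int_I].
by rewrite qbarE int_qbar subee ?mule0// fin_numM// fin_num_measure.
Qed.

Lemma lt_integral_pool (u : R -> R) (slope : R) :
  mu.-integrable setT (EFin \o u) ->
  (forall q, I q -> q != qbar -> (u q < u qbar + slope * (q - qbar))%R) ->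
  0 < mu (I `\ qbar) ->
  \int[mu]_q (u q)%:E < \int[mu]_q (u (pool q))%:E.
Proof.
move=> u_int below_tangent I_qbar_gt0.
have mIC := measurableC mI; have u_meas := measurable_int _ u_int.
have up_meas : measurable_fun setT (fun q => (u (pool q))%:E).
  exact: measurableT_comp u_meas measurable_pool.
rewrite [ltLHS](integral_setID _ mI)// [ltRHS](integral_setID _ mI)// !setTI !setTD.
have -> : \int[mu]_(q in ~` I) (u (pool q))%:E = \int[mu]_(q in ~` I) (u q)%:E.
  by apply: eq_integral => q /set_mem Iq; rewrite pool_notin.
have slope_int : mu.-integrable I (EFin \o (fun q => slope * (q - qbar))%R).
  by have := integrableZl mI slope deviation_int; exact: eq_integrable.
have u_int_IC := integrableS measurableT mIC (@subsetT _ _) u_int.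
rewrite lteD2rE; last exact: integrable_fin_num u_int_IC.
have -> : \int[mu]_(q in I) (u (pool q))%:E =
    \int[mu]_(q in I) (u qbar + slope * (q - qbar))%:E.
  under [RHS]eq_integral do rewrite EFinD.
  rewrite integralD_EFin//; last exact: cst_int_I.
  rewrite [X in _ = _ + X](integral_deviation slope) adde0.
  by apply: eq_integral => q /set_mem Iq; rewrite pool_in.
apply: (lt_integral mI _ _ _ _ _ _ I_qbar_gt0).
- by apply: measurableD => //; exact: measurable_set1.
- exact: subDsetl.
- exact: int_on_I u_int.
- by have := integrableD mI (cst_int_I (u qbar)) slope_int; exact: eq_integrable.
- move=> q Iq; have [->|q_neq] := eqVneq q qbar; first by rewrite subrr mulr0 addr0.
  exact/ltW/below_tangent.
- by move=> q [Iq /= /eqP]; exact: below_tangent.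
Qed.

End pooling.

Lemma supported_integrable d (T : measurableType d) (R : realType)
    (P : probability T R) (S : set T) (h : T -> R) (B : R) : measurable S ->
  P S = 1%E -> measurable_fun setT h -> (forall t, S t -> `|h t| <= B) ->
  P.-integrable setT (EFin \o h).
Proof.
move=> mS PS1 h_meas h_leB; apply/integrableP; split; first exact/measurable_EFinP.
have PSC0 : P (~` S) = 0%E by rewrite probability_setC// PS1 subee.
apply: (@le_lt_trans _ _ (\int[P]_t (cst `|B|%:E t))%E).
  apply: (ge0_le_integral_off_null (measurableC mS) PSC0) => //= t /contrapT St.
  by rewrite lee_fin (le_trans (h_leB _ St))// ler_norm.
by rewrite integral_cst// [X in (_ * X)%E]probability_setT mule1 ltry.
Qed.

Section conditional_mean.
Context (R : realType) (mu : probability R R) (q1 q2 : R).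
Hypothesis mu_int : mu.-integrable setT (EFin \o @id R).
Local Notation I := (`]q1, q2[%classic : set R).
Hypothesis I_gt0 : (0 < mu I)%E.

Definition conditional_mean : R := (\int[mu]_(q in I) q) / fine (mu I).

Let I_fin : mu I \is a fin_num. Proof. exact: fin_num_measure. Qed.

Let fine_I_gt0 : 0 < fine (mu I).
Proof. by rewrite fine_gt0// I_gt0 ltey_eq I_fin. Qed.

Let id_int : mu.-integrable I (EFin \o @id R).
Proof. exact: (integrableS measurableT (measurable_itv _) (@subsetT _ I)). Qed.

Let cst_int (r : R) : mu.-integrable I (EFin \o cst r).
Proof. exact: finite_measure_integrable_cst. Qed.

Lemma conditional_meanE :
  (\int[mu]_(q in I) q%:E = conditional_mean%:E * mu I)%E.
Proof.
rewrite -(fineK I_fin) -EFinM divfK ?gt_eqF// fineK//.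
exact: integrable_fin_num id_int.
Qed.

Lemma conditional_mean_in : conditional_mean \in `[q1, q2].
Proof.
rewrite in_itv/= ler_pdivlMr// ler_pdivrMr// -!Rintegral_cst//.
apply/andP; split; apply: le_Rintegral => //; first exact: cst_int.
- by move=> q; rewrite /= in_itv/= => /andP[/ltW].
- exact: cst_int.
- by move=> q; rewrite /= in_itv/= => /andP[_ /ltW].
Qed.

End conditional_mean.

Section full_support.
Context (R : realType) (mu : probability R R) (a b : R).
Hypothesis full_supp : forall x : R, x \in `[a, b] -> forall e : R, 0 < e ->
  (0 < mu `](x - e)%R, (x + e)%R[%classic)%E.

Lemma open_interval_gt0 (x y : R) : a <= x -> x < y -> y <= b ->
  (0 < mu (`]x, y[%classic : set R))%E.
Proof.
move=> ax xy yb; pose mid := (x + y) / 2; pose e := (y - x) / 2.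
have mid_in : mid \in `[a, b] by rewrite in_itv/= /mid; apply/andP; split; lra.
have e_gt0 : 0 < e by rewrite /e; lra.
have := full_supp mid_in e_gt0.
have -> : mid - e = x by rewrite /mid /e; field.
by have -> : mid + e = y by rewrite /mid /e; field.
Qed.

Lemma punctured_interval_gt0 (x y q : R) : a <= x -> x < y -> y <= b ->
  (0 < mu ((`]x, y[ : set R) `\ q))%E.
Proof.
move=> ax xy yb; pose mid := (x + y) / 2.
have [x_mid mid_y] : x < mid /\ mid < y by split; rewrite /mid; lra.
have mIq : measurable ((`]x, y[ : set R) `\ q).
  by apply: measurableD => //; exact: measurable_set1.
have [q_mid|mid_q] := leP q mid.
- apply: (lt_le_trans (open_interval_gt0 (le_trans ax (ltW x_mid)) mid_y yb)).
  apply: le_measure; rewrite ?inE// => z; rewrite /= !in_itv/= => /andP[mid_z ->].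
  rewrite (lt_trans x_mid mid_z); split=> // z_q.
  by rewrite z_q ltNge q_mid in mid_z.
- apply: (lt_le_trans (open_interval_gt0 ax x_mid (le_trans (ltW mid_y) yb))).
  apply: le_measure; rewrite ?inE// => z; rewrite /= !in_itv/= => /andP[-> z_mid].
  rewrite (lt_trans z_mid mid_y); split=> // z_q.
  by rewrite z_q ltNge (ltW mid_q) in z_mid.
Qed.

End full_support.

(** * Comparison of information structures *)

Definition payoff_increasing_in_information (R : realType) (ql qh : R)
    (mu : probability R R) (f p : R -> R) : Prop :=
  forall (d : measure_display) (X : measurableType d) (pi : R -> probability X R)
    (d' : measure_display) (X' : measurableType d') (pi' : R -> probability X' R)
    (m : X -> R) (m' : X' -> R),
  is_info_kernel pi -> is_info_kernel pi' -> more_informative ql qh pi' pi ->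
  is_posterior_mean mu pi m -> is_posterior_mean mu pi' m' ->
  (buyer_payoff mu pi m f p <= buyer_payoff mu pi' m' f p)%E.

Definition full_revelation_optimal (R : realType) (mu : probability R R)
    (f p : R -> R) : Prop :=
  forall (d : measure_display) (X : measurableType d) (pi : R -> probability X R)
    (m : X -> R) (mF : R -> R),
  is_info_kernel pi -> is_posterior_mean mu pi m ->
  is_posterior_mean mu (@full_revelation R) mF ->
  (buyer_payoff mu pi m f p <= buyer_payoff mu (@full_revelation R) mF f p)%E.

(* Every information structure is a garbling of full revelation, by itself. *)
Lemma full_revelation_optimal_of_increasing (R : realType) (ql qh : R)
    (mu : probability R R) (f p : R -> R) :
  payoff_increasing_in_information ql qh mu f p -> full_revelation_optimal mu f p.
Proof.
move=> increasing d X pi m mF pi_kernel m_post mF_post; apply: increasing => //.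
  exact: (dirac_kernel (@measurable_id _ _ setT)).
exists pi; split=> [A mA|q _ A mA]; first exact: pi_kernel.
by rewrite integral_dirac ?diracT ?mul1e//; exact: pi_kernel.
Qed.

(** * Hazard rate, virtual valuation and option value of a density on [0, 1] *)

Section density.
Context (R : realType) (f : R -> R).
Local Notation leb := (@lebesgue_measure R).
Local Notation F := (dens_cdf f).
Local Notation r := (inv_hazard f).
Local Notation psi := (virtual_val f).
Hypothesis f_gt0 : forall v : R, v \in `]0, 1[ -> 0 < f v.
Hypothesis f_total : (\int[leb]_(x in `[0%R, 1%R]) (f x)%:E)%E = 1%E.
Hypothesis f_der : forall v : R, v \in `]0, 1[ ->
  derivable f v 1 /\ derivable (derive1 f) v 1.

Lemma density_is_derive (v : R) : v \in `]0, 1[ -> is_derive v 1 f (derive1 f v).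
Proof. by move=> /f_der[f_v _]; exact: is_derive1_derive1. Qed.

Lemma derive1_density_is_derive (v : R) : v \in `]0, 1[ ->
  is_derive v 1 (derive1 f) (derive1n 2 f v).
Proof. by move=> /f_der[_ df_v]; exact: is_derive1_derive1. Qed.

Lemma density_measurable : measurable_fun (`[0%R : R, 1%R : R]%classic) f.
Proof.
apply: (@measurable_fun_itv_cc _ 0 1 false true).
apply: subspace_continuous_measurable_fun => //.
exact: derivable_within_continuous (fun x x01 => proj1 (f_der x01)).
Qed.

Lemma density_integrable : leb.-integrable `[0%R, 1%R] (EFin \o f).
Proof.
have f_oo : measurable_fun (`]0%R : R, 1%R : R[%classic) (EFin \o f).
  apply/measurable_EFinP; apply: measurable_funS density_measurable => //.
  exact: subset_itv_oo_cc.
apply/integrableP; split.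
  by apply/measurable_EFinP; exact: density_measurable.
suff -> : (\int[leb]_(x in `[0%R, 1%R]) `|(f x)%:E| = 1)%E by rewrite ltry.
rewrite -f_total (@integral_itv_bndoo _ 0 1 _ true false); last first.
  exact: measurableT_comp f_oo.
rewrite (@integral_itv_bndoo _ 0 1 (EFin \o f) true false)//.
by apply: eq_integral => x /[!inE]/= /f_gt0 fx_gt0; rewrite gtr0_norm.
Qed.

Lemma weighted_density_integrable (h : R -> R) :
  measurable_fun (`[0%R : R, 1%R : R]%classic) h ->
  {in `[0, 1], forall v, `|h v| <= 1} ->
  leb.-integrable `[0%R, 1%R] (EFin \o (fun v => h v * f v)).
Proof.
move=> h_meas h_le1; apply: le_integrable density_integrable => //.
  by apply/measurable_EFinP; exact: measurable_funM density_measurable.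
by move=> v v01; rewrite lee_fin normrM ler_piMl// h_le1.
Qed.

Lemma dens_cdf_itv (v : R) : v <= 1 -> F v = (\int[leb]_(x in `[0, v]) f x)%R.
Proof.
move=> v1; rewrite /dens_cdf /Rintegral; congr (fine (integral _ _ _)).
apply/seteqP; split => x /=; rewrite !in_itv/=.
  by move=> [/andP[-> _] ->].
by move=> /andP[-> xv]; rewrite xv (le_trans xv).
Qed.

Lemma dens_cdf_ge1 (v : R) : 1 <= v -> F v = 1.
Proof.
move=> v1; rewrite /dens_cdf (_ : _ `&` _ = `[0%R, 1%R]%classic) ?f_total//.
apply/seteqP; split => x /=; rewrite !in_itv/=; first by case.
by move=> /andP[-> x1]; rewrite x1 (le_trans x1).
Qed.

Lemma dens_cdf_le0 (v : R) : v <= 0 -> F v = 0.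
Proof.
move=> v0; rewrite dens_cdf_itv ?(le_trans v0)//.
have [->|v_neq0] := eqVneq v 0; first by rewrite set_itv1 Rintegral_set1.
by rewrite set_itv_ge ?Rintegral_set0// bnd_simp -ltNge lt_neqAle v_neq0.
Qed.

Lemma dens_cdf_is_derive (v : R) : v \in `]0, 1[ -> is_derive v 1 F (f v).
Proof.
move=> v01; have := v01; rewrite in_itv/= => /andP[v0 v1].
have [F_v dF_v] := continuous_FTC1_closed v1 density_integrable v0
  (is_derive1_continuous (density_is_derive v01)).
apply: (@near_eq_is_derive _ _ _
  (fun y : R => \int[leb]_(x in `[0%R, y]) f x : R)%R); last first.
  by rewrite -dF_v; exact: is_derive1_derive1.
near=> y; rewrite dens_cdf_itv// ltW//.
have : y \in `]0, 1[ by near: y; exact: near_in_itvoo.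
by rewrite in_itv/= => /andP[].
Unshelve. all: by end_near. Qed.

Lemma dens_ccdf_is_derive (v : R) : v \in `]0, 1[ ->
  is_derive v 1 (fun t => 1 - F t) (- f v).
Proof.
move=> v01; rewrite -[- f v]sub0r.
exact: is_deriveB (is_derive_cst (1 : R) v 1) (dens_cdf_is_derive v01).
Qed.

Lemma dens_ccdfE (v : R) : 0 <= v <= 1 ->
  1 - F v = (\int[leb]_(x in `]v, 1]) f x)%R.
Proof.
move=> /andP[v0 v1]; rewrite -[X in X - _](dens_cdf_ge1 (lexx 1)) !dens_cdf_itv//.
by rewrite Rintegral_itvB ?bnd_simp//; exact: density_integrable.
Qed.

Lemma dens_cdf_le1 (v : R) : F v <= 1.
Proof.
have [v0|v0] := leP v 0; first by rewrite dens_cdf_le0.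
have [v1|v1] := leP 1 v; first by rewrite dens_cdf_ge1.
rewrite -subr_ge0 dens_ccdfE ?(ltW v0) ?(ltW v1)//.
rewrite -Rintegral_itv_bndo_bndc.
  apply: Rintegral_ge0 => x /=; rewrite in_itv/= => /andP[vx x1].
  by apply/ltW/f_gt0; rewrite in_itv/= x1 (lt_trans v0).
apply: integrableS density_integrable => // x /=; rewrite !in_itv/= => /andP[vx x1].
by rewrite !ltW// (lt_trans v0).
Qed.

Lemma dens_cdf_increasing : {in `]0, 1[ &, {homo F : x y / x < y}}.
Proof.
apply: gtr0_derive1_lt_oo => v v01; last 1 first.
- by move: v01 => /set_mem/dens_cdf_is_derive; exact: is_derive1_continuous.
- by case: (dens_cdf_is_derive v01).
- by rewrite (is_derive1_val (dens_cdf_is_derive v01)) f_gt0.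
Qed.

Lemma dens_cdf_lt1 (v : R) : v < 1 -> F v < 1.
Proof.
move=> v1; have [v0|v0] := leP v 0; first by rewrite dens_cdf_le0.
apply: lt_le_trans (dens_cdf_le1 ((v + 1) / 2)).
by apply: dens_cdf_increasing; rewrite ?in_itv/= ?v0 ?v1//; lra.
Qed.

Definition partial_moment (v : R) := (\int[leb]_(x in `[0, v]) (x * f x))%R.
Local Notation K := partial_moment.

Lemma moment_integrable : leb.-integrable `[0%R, 1%R] (EFin \o (fun v => v * f v)).
Proof.
apply: weighted_density_integrable => // v; rewrite in_itv/= => /andP[v0 v1].
by rewrite ger0_norm.
Qed.

Lemma partial_moment_is_derive (v : R) : v \in `]0, 1[ -> is_derive v 1 K (v * f v).
Proof.
move=> v01; have := v01; rewrite in_itv/= => /andP[v0 v1].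
have [|K_v dK_v] := continuous_FTC1_closed v1 moment_integrable v0.
  exact: is_derive1_continuous (is_derive1M (is_derive_id v 1) (density_is_derive v01)).
by rewrite -dK_v; exact: is_derive1_derive1.
Qed.

(* For [y] in [0, 1] this is [E (v - y)^+] (see [excessE]), written so that the
   fundamental theorem of calculus applies. *)
Definition excess (y : R) := K 1 - K y - y * (1 - F y).

Lemma excess_is_derive (y : R) : y \in `]0, 1[ -> is_derive y 1 excess (- (1 - F y)).
Proof.
move=> y01.
have := is_deriveB
  (is_deriveB (is_derive_cst (K 1) y 1) (partial_moment_is_derive y01))
  (is_derive1M (is_derive_id y 1) (dens_ccdf_is_derive y01)).
by move/is_derive_eq; apply => /=; ring.
Qed.

Lemma excess_integrable (y : R) : 0 <= y <= 1 ->
  leb.-integrable `[0%R, 1%R] (EFin \o (fun v => Num.max (v - y) 0 * f v)).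
Proof.
move=> /andP[y0 y1]; apply: weighted_density_integrable.
  by apply: measurable_maxr => //; exact: measurable_funB.
move=> v; rewrite in_itv/= => /andP[v0 v1].
by rewrite ger0_norm ?le_max ?lexx ?orbT// ge_max; lra.
Qed.

Lemma excessE (y : R) : 0 <= y <= 1 ->
  (\int[leb]_(v in `[0%R, 1%R]) (Num.max (v - y) 0 * f v)%:E = (excess y)%:E)%E.
Proof.
move=> /andP[y0 y1].
have restrict (g : R -> \bar R) :
    leb.-integrable `[0%R, 1%R] g -> leb.-integrable `]y, 1%R] g.
  by apply: integrableS => //; apply: subset_itvr; rewrite bnd_simp.
have f_int := restrict _ density_integrable.
have vf_int := restrict _ moment_integrable.
have yf_int : leb.-integrable `]y, 1%R] (EFin \o (fun v => y * f v)).
  exact: integrableZl f_int.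
have int_max : (\int[leb]_(v in `[0%R, 1%R]) (Num.max (v - y) 0 * f v)%:E =
    \int[leb]_(v in `]y, 1%R]) (v * f v - y * f v)%:E)%E.
  rewrite [LHS]integral_mkcond [RHS]integral_mkcond; apply: eq_integral => v _.
  rewrite !patchE !mem_setE !in_itv/=; have [yv|vy] := ltP y v.
    by rewrite max_l ?subr_ge0 ?(ltW yv)// (le_trans y0 (ltW yv))/= mulrBl.
  by rewrite max_r ?subr_le0// mul0r; case: ifP.
rewrite -[LHS]fineK ?int_max; last first.
  exact/integrable_fin_num/(integrableB _ vf_int yf_int).
rewrite -/(Rintegral _ _ _) RintegralB// RintegralZl// -dens_ccdfE ?y0//.
by rewrite /excess /K Rintegral_itvB ?bnd_simp//; exact: moment_integrable.
Qed.

Lemma excess_ge0 (y : R) : 0 <= y <= 1 -> 0 <= excess y.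
Proof.
move=> y01; rewrite -lee_fin -excessE//.
rewrite (@integral_itv_bndoo _ 0 1 _ true false).
  apply: integral_ge0 => v /= /f_gt0 fv_gt0.
  by rewrite lee_fin mulr_ge0 ?le_max ?lexx ?orbT// ltW.
have /integrableP[max_meas _] := excess_integrable y01.
by apply: measurable_funS max_meas => //; exact: subset_itv_oo_cc.
Qed.

Lemma excess_nonincreasing : {in `]0, 1[ &, {homo excess : x y /~ x <= y}}.
Proof.
apply: ler0_derive1_le_oo => y y01; last 1 first.
- by move: y01 => /set_mem/excess_is_derive; exact: is_derive1_continuous.
- by case: (excess_is_derive y01).
- rewrite (is_derive1_val (excess_is_derive y01)).
  by rewrite oppr_le0 subr_ge0 dens_cdf_le1.
Qed.

Lemma inv_hazard_is_derive (v : R) : v \in `]0, 1[ ->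
  is_derive v 1 r (- 1 - r v * (derive1 f v / f v)).
Proof.
move=> v01; have fv_neq0 : f v != 0 by rewrite gt_eqF// f_gt0.
have := is_derive1_div (dens_ccdf_is_derive v01) (density_is_derive v01) fv_neq0.
by move/is_derive_eq; apply; rewrite /inv_hazard; field.
Qed.

Lemma inv_hazard_derivable (v : R) : v \in `]0, 1[ -> derivable r v 1.
Proof. by case/inv_hazard_is_derive. Qed.

Lemma derive1_inv_hazard_is_derive (v : R) : v \in `]0, 1[ ->
  is_derive v 1 (derive1 r) (- (derive1 r v * (derive1 f v / f v) +
    r v * ((derive1n 2 f v * f v - derive1 f v * derive1 f v) / f v ^+ 2))).
Proof.
move=> v01; have fv_neq0 : f v != 0 by rewrite gt_eqF// f_gt0.
apply: near_eq_is_derive (near_derive1 inv_hazard_is_derive v01) _.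
have d_log := is_derive1_div (derive1_density_is_derive v01)
  (density_is_derive v01) fv_neq0.
have := is_deriveB (is_derive_cst (- 1 : R) v 1)
  (is_derive1M (is_derive1_derive1 (inv_hazard_derivable v01)) d_log).
by rewrite sub0r.
Qed.

Lemma derive1_inv_hazard_derivable (v : R) : v \in `]0, 1[ ->
  derivable (derive1 r) v 1.
Proof. by case/derive1_inv_hazard_is_derive. Qed.

Lemma virtual_val_is_derive (v : R) : v \in `]0, 1[ ->
  is_derive v 1 psi (1 - derive1 r v).
Proof.
move=> /inv_hazard_derivable/is_derive1_derive1.
exact: is_deriveB (is_derive_id v 1).
Qed.

Lemma derive1_virtual_val (v : R) : v \in `]0, 1[ -> derive1 psi v = 1 - derive1 r v.
Proof. by move=> /virtual_val_is_derive/is_derive1_val. Qed.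

Definition hazard_curvature (v : R) := r v * derive1n 2 r v + derive1 r v.

(* By the first-order condition [psi y = c / q] at the optimal normalized price
   [y], this is the derivative in [q] of Buyer's payoff [q * excess y]. *)
Definition marginal_payoff (y : R) :=
  excess y + psi y * (1 - F y) / (1 - derive1 r y).
Local Notation W := marginal_payoff.

Lemma marginal_payoff_is_derive (y : R) : y \in `]0, 1[ -> 0 < derive1 psi y ->
  is_derive y 1 W (psi y * f y / derive1 psi y ^+ 2 * (hazard_curvature y - 1)).
Proof.
move=> y01; rewrite derive1_virtual_val// => dpsi_gt0.
have fy_neq0 : f y != 0 by rewrite gt_eqF// f_gt0.
have dpsi_neq0 : 1 - derive1 r y != 0 by rewrite gt_eqF.
have ddpsi := is_deriveB (is_derive_cst (1 : R) y 1)
  (is_derive1_derive1 (derive1_inv_hazard_derivable y01)).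
have := is_deriveD (excess_is_derive y01) (is_derive1_div
  (is_derive1M (virtual_val_is_derive y01) (dens_ccdf_is_derive y01)) ddpsi dpsi_neq0).
move/is_derive_eq; apply; rewrite /hazard_curvature /= [r y in RHS]/inv_hazard.
rewrite -[(cst 1 - derive1 r) y]/(1 - derive1 r y).
by field; rewrite fy_neq0 dpsi_neq0.
Qed.

Hypothesis f_cont2 : {in `]0, 1[, continuous (derive1n 2 f)}.

Lemma hazard_curvature_continuous (v : R) : v \in `]0, 1[ ->
  {for v, continuous hazard_curvature}.
Proof.
move=> v01; have fv_neq0 : f v != 0 by rewrite gt_eqF// f_gt0.
have cf := is_derive1_continuous (density_is_derive v01).
have cdf := is_derive1_continuous (derive1_density_is_derive v01).
have cr := is_derive1_continuous (inv_hazard_is_derive v01).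
have cdr := is_derive1_continuous (derive1_inv_hazard_is_derive v01).
have ddr_near : \forall t \near v, _ = derive1n 2 r t :=
  near_derive1 derive1_inv_hazard_is_derive v01.
apply: cvgD => //; apply: cvgM => //; rewrite -(nbhs_singleton ddr_near).
apply: cvg_trans; first exact: near_eq_cvg ddr_near.
have c_inv : (f t)^-1 @[t --> v] --> (f v)^-1 by exact: cvgV.
have c_inv2 : (f t ^+ 2)^-1 @[t --> v] --> (f v ^+ 2)^-1.
  by apply: cvgV; [rewrite expf_neq0|exact: cvgM].
apply: cvgN; apply: cvgD; first by apply: cvgM => //; exact: cvgM.
apply: cvgM => //; apply: cvgM => //; apply: cvgB; last exact: cvgM.
by apply: cvgM => //; exact: f_cont2.
Qed.

Lemma marginal_payoff_ge0 (y : R) : y \in `]0, 1[ -> 0 < psi y ->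
  0 < derive1 psi y -> 0 <= W y.
Proof.
move=> y01 psi_gt0; rewrite derive1_virtual_val// => dpsi_gt0.
rewrite addr_ge0//; last first.
  rewrite divr_ge0 ?(ltW dpsi_gt0)// mulr_ge0 ?(ltW psi_gt0)//.
  by rewrite subr_ge0 dens_cdf_le1.
by move: y01; rewrite in_itv/= => /andP[y0 y1]; rewrite excess_ge0// !ltW.
Qed.

Hypothesis psi_reg : forall v : R, v \in `]0, 1[ -> 0 < psi v -> 0 < derive1 psi v.

Lemma virtual_val_increasing (a b : R) : 0 < a -> b < 1 -> 0 < psi a ->
  {in `[a, b] &, {homo psi : x y / x < y}}.
Proof.
move=> a0 b1 psia_gt0.
have in01 x : x \in `[a, b] -> x \in `]0, 1[.
  by rewrite !in_itv/= => /andP[ax xb]; rewrite (lt_le_trans a0)// (le_lt_trans xb).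
apply: increasing_of_derive1_gt0_where_gt0 psia_gt0 => x /in01 x01.
  by case: (virtual_val_is_derive x01).
exact: psi_reg.
Qed.

(** * Optimal prices and Buyer's payoff as a function of the quality *)

Section optimal_price.
Variables (ql qh c : R) (p : R -> R).
Hypothesis c_gt0 : 0 < c.
Hypothesis c_lt_ql : c < ql.
Hypothesis ql_lt_qh : ql < qh.
Hypothesis p_opt : forall q : R, q \in `[ql, qh] -> forall p' : R, p' != p q ->
  (p' - c) * (1 - F (p' / q)) < (p q - c) * (1 - F (p q / q)).

Definition norm_price (q : R) := p q / q.
Local Notation pbar := norm_price.

Lemma quality_gt_cost (q : R) : q \in `[ql, qh] -> c < q.
Proof. by rewrite in_itv/= => /andP[+ _]; exact: lt_le_trans. Qed.

Lemma quality_gt0 (q : R) : q \in `[ql, qh] -> 0 < q.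
Proof. by move=> /quality_gt_cost; exact: lt_trans. Qed.

Lemma norm_price_in01 (q : R) : q \in `[ql, qh] -> pbar q \in `]0, 1[.
Proof.
move=> qQ; have cq := quality_gt_cost qQ; have q0 := quality_gt0 qQ.
pose mid_price := (c + q) / 2.
have mid_profit_gt0 : 0 < (mid_price - c) * (1 - F (mid_price / q)).
  rewrite mulr_gt0//; first by rewrite /mid_price; lra.
  rewrite subr_gt0; apply: dens_cdf_lt1.
  by rewrite ltr_pdivrMr// mul1r /mid_price; lra.
have profit_gt0 : 0 < (p q - c) * (1 - F (p q / q)).
  have [<-//|/(p_opt qQ)] := eqVneq mid_price (p q).
  exact: (lt_trans mid_profit_gt0).
have pc : c < p q.
  rewrite ltNge; apply: contraL profit_gt0 => pc.
  by rewrite -leNgt mulr_le0_ge0 ?subr_le0 ?subr_ge0 ?dens_cdf_le1.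
rewrite in_itv/= divr_gt0 ?(lt_trans c_gt0)//= ltNge.
apply: contraL profit_gt0 => pbar_ge1.
by rewrite (dens_cdf_ge1 pbar_ge1) subrr mulr0 ltxx.
Qed.

Lemma virtual_val_norm_price (q : R) : q \in `[ql, qh] -> psi (pbar q) = c / q.
Proof.
move=> qQ; have q0 := quality_gt0 qQ; have y01 := norm_price_in01 qQ.
have q_neq0 : q != 0 by rewrite gt_eqF.
pose profit (y : R) := (q * y - c) * (1 - F y).
have profit_is_derive (y : R) : y \in `]0, 1[ ->
    is_derive y 1 profit (q * (1 - F y) - (q * y - c) * f y).
  move=> /dens_ccdf_is_derive ccdf_is_derive.
  have := is_derive1M (is_deriveB (is_deriveZ q (is_derive_id y 1))
    (is_derive_cst c y 1)) ccdf_is_derive.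
  move/is_derive_eq; apply; rewrite subr0 mulrN.
  by rewrite /GRing.scale/= mulr1.
have profit_max (y : R) : y \in `]0, 1[ -> profit y <= profit (pbar q).
  have pbarE : q * pbar q = p q by rewrite /norm_price; field.
  have yE : y = q * y / q by field.
  move=> _; rewrite /profit pbarE [in F y]yE.
  by have [->//|y_neq] := eqVneq (q * y) (p q); exact/ltW/p_opt.
have [_ first_order] : is_derive (pbar q) 1 profit 0.
  apply: (derive1_at_max ler01 _ y01 profit_max) => y.
  by case/profit_is_derive => profit_y _; exact: profit_y.
have [_] := profit_is_derive _ y01.
rewrite first_order => /esym/eqP; rewrite subr_eq0 => /eqP ccdfE.
have f_neq0 : f (pbar q) != 0 by rewrite gt_eqF// f_gt0.
have -> : psi (pbar q) = pbar q - q * (1 - F (pbar q)) / (q * f (pbar q)).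
  by rewrite /virtual_val /inv_hazard; field; rewrite f_neq0.
by rewrite ccdfE; field; rewrite f_neq0 q_neq0.
Qed.

Lemma virtual_val_norm_price_gt0 (q : R) : q \in `[ql, qh] -> 0 < psi (pbar q).
Proof.
move=> qQ; rewrite virtual_val_norm_price//.
exact: divr_gt0 c_gt0 (quality_gt0 qQ).
Qed.

Lemma norm_price_decreasing : {in `[ql, qh] &, {homo pbar : q q' /~ q < q'}}.
Proof.
move=> q q' qQ q'Q; apply: contraTT; rewrite -!leNgt => pbar_le.
have := norm_price_in01 qQ; have := norm_price_in01 q'Q.
rewrite !in_itv/= => /andP[pbar'_gt0 _] /andP[_ pbar_lt1].
have psi_ndecr := ltW_homo_in (virtual_val_increasing pbar'_gt0 pbar_lt1
  (virtual_val_norm_price_gt0 q'Q)).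
have : psi (pbar q') <= psi (pbar q).
  by apply: psi_ndecr; rewrite ?in_itv/= ?lexx ?pbar_le.
by rewrite !virtual_val_norm_price// ler_pM2l// lef_pV2// posrE quality_gt0.
Qed.

Lemma norm_price_nonincreasing : {in `[ql, qh] &, {homo pbar : q q' /~ q <= q'}}.
Proof. exact: ltW_nhomo_in norm_price_decreasing. Qed.

Let ql_in : ql \in `[ql, qh]. Proof. by rewrite in_itv/= lexx ltW. Qed.
Let qh_in : qh \in `[ql, qh]. Proof. by rewrite in_itv/= lexx ltW. Qed.
Local Notation P := `[pbar qh, pbar ql].

Lemma norm_price_in_range (q : R) : q \in `[ql, qh] -> pbar q \in P.
Proof.
move=> qQ; have := qQ; rewrite !in_itv/= => /andP[lq qh'].
by rewrite !norm_price_nonincreasing.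
Qed.

Lemma price_range_in01 (y : R) : y \in P -> y \in `]0, 1[.
Proof.
have := norm_price_in01 ql_in; have := norm_price_in01 qh_in.
rewrite !in_itv/= => /andP[pbar_qh_gt0 _] /andP[_ pbar_ql_lt1] /andP[qh_y y_ql].
by rewrite (lt_le_trans pbar_qh_gt0)// (le_lt_trans y_ql).
Qed.

Lemma virtual_val_price_range_increasing : {in P &, {homo psi : x y / x < y}}.
Proof.
have := norm_price_in01 ql_in; have := norm_price_in01 qh_in.
rewrite !in_itv/= => /andP[pbar_qh_gt0 _] /andP[_ pbar_ql_lt1].
exact: virtual_val_increasing (virtual_val_norm_price_gt0 qh_in).
Qed.

Lemma virtual_val_price_range_bounds (y : R) : y \in P -> c / qh <= psi y <= c / ql.
Proof.
have psi_ndecr := ltW_homo_in virtual_val_price_range_increasing.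
move=> yP; have := yP; rewrite in_itv/= => /andP[qh_y y_ql].
by rewrite -!virtual_val_norm_price// !psi_ndecr// norm_price_in_range.
Qed.

Lemma virtual_val_price_range_gt0 (y : R) : y \in P -> 0 < psi y.
Proof.
move=> /virtual_val_price_range_bounds/andP[+ _]; apply: lt_le_trans.
exact: divr_gt0 c_gt0 (quality_gt0 qh_in).
Qed.

Lemma derive1_virtual_val_gt0 (y : R) : y \in P -> 0 < derive1 psi y.
Proof.
move=> yP; apply: psi_reg; first exact: price_range_in01.
exact: virtual_val_price_range_gt0.
Qed.

Definition optimal_quality (y : R) := c / psi y.
Definition optimal_quality_slope (y : R) := - (c * derive1 psi y / psi y ^+ 2).

Lemma norm_priceK : {in `[ql, qh], cancel pbar optimal_quality}.
Proof.
move=> q qQ; rewrite /optimal_quality virtual_val_norm_price//.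
by rewrite invf_div mulrC divfK// gt_eqF.
Qed.

Lemma optimal_quality_in (y : R) : y \in P -> optimal_quality y \in `[ql, qh].
Proof.
move=> yP; have psi_gt0 := virtual_val_price_range_gt0 yP.
have := virtual_val_price_range_bounds yP.
rewrite ler_pdivrMr ?quality_gt0// ler_pdivlMr ?quality_gt0// => /andP[c_le le_c].
rewrite in_itv/= /optimal_quality ler_pdivlMr// ler_pdivrMr//.
by rewrite (mulrC ql) le_c (mulrC qh).
Qed.

Lemma optimal_qualityK : {in P, cancel optimal_quality pbar}.
Proof.
move=> y yP; have qQ := optimal_quality_in yP.
apply: (inc_inj_in (le_mono_in virtual_val_price_range_increasing)) => //.
  exact: norm_price_in_range.
rewrite virtual_val_norm_price// /optimal_quality invf_div mulrC divfK//.
by rewrite gt_eqF.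
Qed.

Lemma optimal_quality_is_derive (y : R) : y \in P ->
  is_derive y 1 optimal_quality (optimal_quality_slope y).
Proof.
move=> yP; have y01 := price_range_in01 yP.
have psi_neq0 : psi y != 0 by rewrite gt_eqF// virtual_val_price_range_gt0.
have := is_derive1_div (is_derive_cst c y 1) (virtual_val_is_derive y01) psi_neq0.
move/is_derive_eq; apply.
by rewrite /optimal_quality_slope derive1_virtual_val//= mul0r sub0r mulNr.
Qed.

Lemma optimal_quality_slope_lt0 (y : R) : y \in P -> optimal_quality_slope y < 0.
Proof.
move=> yP; rewrite oppr_lt0 divr_gt0// ?exprn_gt0 ?mulr_gt0//.
- exact: derive1_virtual_val_gt0.
- exact: virtual_val_price_range_gt0.
Qed.

Lemma optimal_payoff_is_derive (y : R) : y \in P ->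
  is_derive y 1 (fun y => optimal_quality y * excess y)
    (W y * optimal_quality_slope y).
Proof.
move=> yP; have y01 := price_range_in01 yP.
have psi_neq0 : psi y != 0 by rewrite gt_eqF// virtual_val_price_range_gt0.
have dpsi_neq0 : derive1 psi y != 0 by rewrite gt_eqF// derive1_virtual_val_gt0.
have := is_derive1M (optimal_quality_is_derive yP) (excess_is_derive y01).
move/is_derive_eq; apply.
rewrite /W /optimal_quality /optimal_quality_slope -derive1_virtual_val//.
by field; rewrite psi_neq0 dpsi_neq0.
Qed.

Definition payoff_at (q : R) := q * excess (pbar q).
Definition payoff_slope (q : R) := W (pbar q).
Local Notation U := payoff_at.
Local Notation D := payoff_slope.

Lemma buyer_utilE (q : R) : q \in `[ql, qh] -> buyer_util f p q = (U q)%:E.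
Proof.
move=> qQ; have q0 := quality_gt0 qQ.
have pbar01 : 0 <= pbar q <= 1.
  by have := norm_price_in01 qQ; rewrite in_itv/= => /andP[y0 y1]; rewrite !ltW.
rewrite /buyer_util /U EFinM -excessE// -integralZl//; last exact: excess_integrable.
apply: eq_integral => v _; rewrite -EFinM mulrA; congr ((_ * _)%:E).
rewrite maxr_pMr ?(ltW q0)// mulr0; congr Num.max.
by rewrite /norm_price; field; rewrite gt_eqF.
Qed.

Lemma excess_norm_price_ge0 (q : R) : q \in `[ql, qh] -> 0 <= excess (pbar q).
Proof.
move=> /norm_price_in01; rewrite in_itv/= => /andP[y0 y1].
by rewrite excess_ge0// !ltW.
Qed.

Lemma payoff_at_ge0 (q : R) : q \in `[ql, qh] -> 0 <= U q.
Proof. by move=> qQ; rewrite mulr_ge0 ?excess_norm_price_ge0// ltW// quality_gt0. Qed.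

Lemma payoff_at_nondecreasing : {in `[ql, qh] &, {homo U : q q' / q <= q'}}.
Proof.
move=> q q' qQ q'Q qq'; rewrite ler_pM ?excess_norm_price_ge0//.
  by rewrite ltW// quality_gt0.
by apply: excess_nonincreasing; rewrite ?norm_price_in01// norm_price_nonincreasing.
Qed.

Lemma payoff_slope_ge0 (q : R) : q \in `[ql, qh] -> 0 <= D q.
Proof.
move=> /norm_price_in_range pbarP; apply: marginal_payoff_ge0.
- exact: price_range_in01.
- exact: virtual_val_price_range_gt0.
- exact: derive1_virtual_val_gt0.
Qed.

Lemma marginal_payoff_derivable (y : R) : y \in P -> derivable W y 1.
Proof.
move=> yP; have [W_y _] := marginal_payoff_is_derive (price_range_in01 yP)
  (derive1_virtual_val_gt0 yP).
exact: W_y.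
Qed.

Lemma sgr_derive1_marginal_payoff (y : R) : y \in P ->
  Num.sg (derive1 W y) = Num.sg (hazard_curvature y - 1).
Proof.
move=> yP; have y01 := price_range_in01 yP.
have dpsi_gt0 := derive1_virtual_val_gt0 yP.
rewrite (is_derive1_val (marginal_payoff_is_derive y01 dpsi_gt0)).
rewrite sgrM gtr0_sg ?mul1r// divr_gt0 ?exprn_gt0//.
by rewrite mulr_gt0 ?f_gt0// virtual_val_price_range_gt0.
Qed.

Definition hazard_condition :=
  forall v, pbar qh < v < pbar ql -> hazard_curvature v <= 1.

Lemma payoff_above_tangent : hazard_condition ->
  {in `[ql, qh] &, forall q q', U q + D q * (q' - q) <= U q'}.
Proof.
move=> r_cond q q' qQ q'Q.
have W_nincr : {in P &, {homo W : y z /~ y <= z}}.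
  apply: ler0_derive1_le_cc => [y /subset_itv_oo_cc|y y_oo|].
  - exact: marginal_payoff_derivable.
  - have yP := subset_itv_oo_cc y_oo.
    rewrite -sgr_le0 sgr_derive1_marginal_payoff// sgr_le0 subr_le0.
    exact: r_cond.
  - exact: derivable_within_continuous marginal_payoff_derivable.
have := curve_above_tangent optimal_quality_is_derive optimal_quality_slope_lt0
  optimal_payoff_is_derive W_nincr (norm_price_in_range qQ) (norm_price_in_range q'Q).
by rewrite !norm_priceK.
Qed.

Lemma payoff_slope_nondecreasing : hazard_condition ->
  {in `[ql, qh] &, {homo D : q q' / q <= q'}}.
Proof.
move=> r_cond q q' qQ q'Q; rewrite le_eqVlt => /predU1P[->//|qq'].
have := payoff_above_tangent r_cond qQ q'Q.
have := payoff_above_tangent r_cond q'Q qQ => tangent_q' tangent_q.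
have : 0 <= (D q' - D q) * (q' - q) by lra.
by rewrite pmulr_lge0 ?subr_gt0// subr_ge0.
Qed.

Lemma marginal_payoff_increasing_subinterval : ~ hazard_condition ->
  exists a b, [/\ a < b, {subset `[a, b] <= P} &
    {in `[a, b] &, {homo W : y z / y < z}}].
Proof.
move=> /existsNP[v /not_implyP[v_range /negP]]; rewrite -ltNge => r_cond.
have v_oo : v \in `]pbar qh, pbar ql[ by rewrite in_itv.
have v01 := price_range_in01 (subset_itv_oo_cc v_oo).
have /nbhs_ballP[e /= e_gt0 near_v] : \forall y \near v,
    (y \in `]pbar qh, pbar ql[) /\ 1 < hazard_curvature y.
  near=> y; split; near: y; first exact: near_in_itvoo.
  exact: cvgr_gt (hazard_curvature_continuous v01) _ r_cond.
exists (v - e / 2), (v + e / 2).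
have in_ball y : y \in `[v - e / 2, v + e / 2] -> ball v e y.
  rewrite in_itv/= => /andP[lo_y y_hi].
  by rewrite /ball/= ltr_norml; apply/andP; split; lra.
have sub_P : {subset `[v - e / 2, v + e / 2] <= P}.
  by move=> y /in_ball/near_v[/subset_itv_oo_cc].
split=> //; first by lra.
apply: gtr0_derive1_lt_cc => [y /subset_itv_oo_cc/sub_P|y /subset_itv_oo_cc y_in|].
- exact: marginal_payoff_derivable.
- rewrite -sgr_gt0 sgr_derive1_marginal_payoff ?sub_P// sgr_gt0 subr_gt0.
  by have [] := near_v _ (in_ball _ y_in).
- apply: derivable_within_continuous => y /sub_P.
  exact: marginal_payoff_derivable.
Unshelve. all: by end_near. Qed.

Lemma norm_price_in_subrange (a b q : R) : a \in P -> b \in P ->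
  q \in `[optimal_quality b, optimal_quality a] ->
  q \in `[ql, qh] /\ pbar q \in `[a, b].
Proof.
move=> aP bP; rewrite in_itv/= => /andP[b_q q_a].
have [quality_aQ quality_bQ] := (optimal_quality_in aP, optimal_quality_in bP).
have qQ : q \in `[ql, qh].
  move: quality_aQ quality_bQ; rewrite !in_itv/= => /andP[_ a_qh] /andP[ql_b _].
  by rewrite (le_trans ql_b)// (le_trans q_a).
have := norm_price_nonincreasing qQ quality_bQ b_q.
have := norm_price_nonincreasing quality_aQ qQ q_a.
rewrite !optimal_qualityK// => a_le le_b.
by split=> //; rewrite in_itv/= a_le.
Qed.

Lemma payoff_below_tangent_subinterval : ~ hazard_condition ->
  exists q1 q2, [/\ ql <= q1, q1 < q2, q2 <= qh &
    {in `[q1, q2] &, forall q q', q != q' -> U q' < U q + D q * (q' - q)}].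
Proof.
move=> /marginal_payoff_increasing_subinterval[a [b [ab sub_P W_incr]]].
have aP : a \in P by rewrite sub_P// in_itv/= lexx ltW.
have bP : b \in P by rewrite sub_P// in_itv/= lexx ltW.
have := optimal_quality_in aP; have := optimal_quality_in bP.
rewrite !in_itv/= => /andP[ql_b _] /andP[_ a_qh].
exists (optimal_quality b), (optimal_quality a); split => //.
  exact: (curve_decreasing optimal_quality_is_derive optimal_quality_slope_lt0).
move=> q q' /(norm_price_in_subrange aP bP)[qQ q_ab].
move=> /(norm_price_in_subrange aP bP)[q'Q q'_ab] q_neq.
have := @curve_below_tangent _ a b _ _ _ _
  (sub_in1 sub_P optimal_quality_is_derive)
  (sub_in1 sub_P optimal_quality_slope_lt0)
  (sub_in1 sub_P optimal_payoff_is_derive) W_incr _ _ q_ab q'_ab.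
rewrite !norm_priceK//; apply.
by apply: contra q_neq => /eqP pbarE; rewrite -(norm_priceK qQ) pbarE norm_priceK.
Qed.

Section information.
Variable mu : probability R R.
Hypothesis mu_supp : mu `[ql, qh]%classic = 1%E.
Local Notation kap := (clamp ql qh).

Let ql_gt0 : 0 < ql. Proof. exact: lt_trans c_lt_ql. Qed.

Let payoff_clamp_measurable : measurable_fun setT (U \o kap).
Proof. exact: (measurable_clamp_comp ql_lt_qh payoff_at_nondecreasing). Qed.

Let payoff_clamp_ge0 (t : R) : 0 <= U (kap t).
Proof. exact/payoff_at_ge0/clamp_in. Qed.

Lemma buyer_payoffE d (X : measurableType d) (pi : R -> probability X R)
    (m : X -> R) (pi_kernel : is_info_kernel pi) : is_posterior_mean mu pi m ->
  buyer_payoff mu pi m f p = (\int[mixture mu pi_kernel]_x (U (kap (m x)))%:E)%E.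
Proof.
move=> m_post; rewrite /buyer_payoff.
apply: (posterior_payoff ql_gt0 ql_lt_qh mu_supp _ m_post (g_kap := EFin \o U)).
- exact: buyer_utilE.
- exact/measurable_EFinP.
- by move=> t; rewrite lee_fin.
Qed.

Lemma buyer_payoff_dirac (s : R -> R) : measurable_fun setT s ->
  is_posterior_mean mu (fun q => (dirac (s q) : probability R R)) id ->
  buyer_payoff mu (fun q => (dirac (s q) : probability R R)) id f p =
  (\int[mu]_q (U (kap (s q)))%:E)%E.
Proof.
move=> s_meas s_post; rewrite (buyer_payoffE (dirac_kernel s_meas))//.
rewrite ge0_integral_mixture//; last exact/measurable_EFinP.
apply: eq_integral => q _; rewrite integral_dirac//; last exact/measurable_EFinP.
by rewrite diracT mul1e.
Qed.

Lemma payoff_increasing_of_hazard_condition : hazard_condition ->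
  payoff_increasing_in_information ql qh mu f p.
Proof.
move=> r_cond d X pi d' X' pi' m m' pi_kernel pi'_kernel [g [g_meas pi_garbled]].
move=> m_post m'_post; rewrite !buyer_payoffE//.
apply: (le_integral_garbled ql_gt0 ql_lt_qh mu_supp _ _ m_post m'_post g_meas
  pi_garbled _ payoff_slope_ge0).
- exact: payoff_at_ge0.
- exact: payoff_clamp_measurable.
- exact: payoff_slope_nondecreasing.
- exact: payoff_above_tangent.
Qed.

Let prior_integrable : mu.-integrable setT (EFin \o @id R).
Proof.
apply: (supported_integrable (B := qh) _ mu_supp) => // q /=.
rewrite in_itv/= => /andP[lq qh_ge].
by rewrite ger0_norm// (le_trans (ltW ql_gt0)).
Qed.

Let payoff_clamp_integrable : mu.-integrable setT (EFin \o (U \o kap)).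
Proof.
apply: (supported_integrable (B := U qh) _ mu_supp) => // q /= qQ.
rewrite clamp_id// ger0_norm ?payoff_at_ge0// payoff_at_nondecreasing//.
by move: qQ; rewrite in_itv/= => /andP[].
Qed.

Lemma full_revelation_posterior_mean : is_posterior_mean mu (@full_revelation R) id.
Proof. exact: (dirac_posterior_mean (s := id) prior_integrable). Qed.

Hypothesis full_supp : forall x : R, x \in `[ql, qh] -> forall e : R, 0 < e ->
  (0 < mu `](x - e)%R, (x + e)%R[%classic)%E.

Lemma pooling_beats_full_revelation : ~ hazard_condition ->
  exists s : R -> R, [/\ measurable_fun setT s,
    is_posterior_mean mu (fun q => (dirac (s q) : probability R R)) id &
    (\int[mu]_q (U (kap q))%:E < \int[mu]_q (U (kap (s q)))%:E)%E].
Proof.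
move=> /payoff_below_tangent_subinterval[q1 [q2 [lq1 q12 q2h below_tangent]]].
have I_gt0 := open_interval_gt0 full_supp lq1 q12 q2h.
have qbarE := conditional_meanE prior_integrable I_gt0.
have qbar_in := conditional_mean_in prior_integrable I_gt0.
set qbar := conditional_mean mu q1 q2 in qbarE qbar_in.
pose I := (`]q1, q2[%classic : set R).
have kap_id q : q \in `[q1, q2] -> kap q = q.
  rewrite in_itv/= => /andP[q1q qq2]; apply: clamp_id.
  by rewrite in_itv/= (le_trans lq1)// (le_trans qq2).
exists (pool I qbar); split.
- exact: (measurable_pool qbar (measurable_itv _)).
- exact: (pool_posterior_mean (measurable_itv _) prior_integrable qbarE).
apply: (lt_integral_pool (slope := D qbar) (measurable_itv _) prior_integrable qbarE
  payoff_clamp_integrable).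
- move=> q /subset_itv_oo_cc q_in q_neq; rewrite /= !kap_id//.
  by apply: below_tangent => //; rewrite eq_sym.
- exact: (punctured_interval_gt0 full_supp qbar lq1 q12 q2h).
Qed.

Lemma hazard_condition_of_optimal :
  full_revelation_optimal mu f p -> hazard_condition.
Proof.
move=> optimal; apply: contrapT => /pooling_beats_full_revelation[s [s_meas s_post]].
rewrite ltNge -(buyer_payoff_dirac s_meas s_post).
rewrite -(buyer_payoff_dirac (@measurable_id _ _ setT) full_revelation_posterior_mean).
move=> /negP; apply; exact: optimal (dirac_kernel s_meas) s_post
  full_revelation_posterior_mean.
Qed.

End information.

End optimal_price.

End density.

Unset Implicit Arguments.

Theorem theorem1 (R : realType) (ql qh c : R) (f : R -> R) (p : R -> R)
    (mu : probability R R) :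
  0 < ql -> ql < qh -> 0 < c -> c < ql ->
  (* F has support [0,1] and a C^2 positive density f on (0,1) *)
  (forall v, v \in `]0, 1[ -> 0 < f v) ->
  (\int[@lebesgue_measure R]_(x in `[0%R, 1%R]) (f x)%:E)%E = 1%E ->
  (forall v, v \in `]0, 1[ -> derivable f v 1 /\ derivable (derive1 f) v 1) ->
  {in `]0, 1[, continuous (derive1n 2 f)} ->
  (* psi' > 0 whenever psi > 0 *)
  (forall v, v \in `]0, 1[ -> 0 < virtual_val f v -> 0 < derive1 (virtual_val f) v) ->
  (* p(q) is the unique maximizer of (p - c)(1 - F(p/q)) *)
  (forall q, q \in `[ql, qh] -> forall p', p' != p q ->
     (p' - c) * (1 - dens_cdf f (p' / q)) < (p q - c) * (1 - dens_cdf f (p q / q))) ->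
  (* prior mu on Q with support Q *)
  mu `[ql, qh]%classic = 1%E ->
  (forall x, x \in `[ql, qh] -> forall e : R, 0 < e ->
     (0 < mu `](x - e)%R, (x + e)%R[%classic)%E) ->
  let r := inv_hazard f in
  let pbar := fun q => p q / q in
  [/\
   (* (1) <-> (2) *)
   ((forall (d : measure_display) (X : measurableType d) (pi : R -> probability X R)
        (d' : measure_display) (X' : measurableType d') (pi' : R -> probability X' R)
        (m : X -> R) (m' : X' -> R),
       is_info_kernel pi -> is_info_kernel pi' ->
       more_informative ql qh pi' pi ->
       is_posterior_mean mu pi m -> is_posterior_mean mu pi' m' ->
       (buyer_payoff mu pi m f p <= buyer_payoff mu pi' m' f p)%E)
    <->
    (forall (d : measure_display) (X : measurableType d) (pi : R -> probability X R)
        (m : X -> R) (mF : R -> R),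
       is_info_kernel pi ->
       is_posterior_mean mu pi m -> is_posterior_mean mu (@full_revelation R) mF ->
       (buyer_payoff mu pi m f p <= buyer_payoff mu (@full_revelation R) mF f p)%E)),
   (* (2) <-> (3) *)
   ((forall (d : measure_display) (X : measurableType d) (pi : R -> probability X R)
        (m : X -> R) (mF : R -> R),
       is_info_kernel pi ->
       is_posterior_mean mu pi m -> is_posterior_mean mu (@full_revelation R) mF ->
       (buyer_payoff mu pi m f p <= buyer_payoff mu (@full_revelation R) mF f p)%E)
    <->
    (forall v, pbar qh < v < pbar ql -> r v * derive1n 2 r v + derive1 r v <= 1))
   &
   (* (1) <-> (3) *)
   ((forall (d : measure_display) (X : measurableType d) (pi : R -> probability X R)
        (d' : measure_display) (X' : measurableType d') (pi' : R -> probability X' R)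
        (m : X -> R) (m' : X' -> R),
       is_info_kernel pi -> is_info_kernel pi' ->
       more_informative ql qh pi' pi ->
       is_posterior_mean mu pi m -> is_posterior_mean mu pi' m' ->
       (buyer_payoff mu pi m f p <= buyer_payoff mu pi' m' f p)%E)
    <->
    (forall v, pbar qh < v < pbar ql -> r v * derive1n 2 r v + derive1 r v <= 1))].
Proof.
move=> ql_gt0 ql_lt_qh c_gt0 c_lt_ql f_gt0 f_total f_der f_cont2 psi_reg p_opt.
move=> mu_supp full_supp r pbar.
have optimal_of_increasing := @full_revelation_optimal_of_increasing R ql qh mu f p.
have cond_of_optimal := hazard_condition_of_optimal f_gt0 f_total f_der f_cont2
  psi_reg c_gt0 c_lt_ql ql_lt_qh p_opt mu_supp full_supp.
have increasing_of_cond := payoff_increasing_of_hazard_condition f_gt0 f_total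
  f_der psi_reg c_gt0 c_lt_ql ql_lt_qh p_opt mu_supp.
split; split.
- exact: optimal_of_increasing.
- by move=> /cond_of_optimal/increasing_of_cond.
- exact: cond_of_optimal.
- by move=> /increasing_of_cond/optimal_of_increasing.
- by move=> /optimal_of_increasing/cond_of_optimal.
- exact: increasing_of_cond.
Qed.
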